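(* Let $\mathcal{H}$ be a toric hyperplane arrangement on $T^n$ whose induced subdivision of $T^n$ is a regular cell complex, with face poset $T_t$ and intersection poset $\mathcal{P}$. Let $c=\{\hat0=x_0<x_1<\dots<x_k=\hat1\}$ be a chain in $\mathcal{P}\cup\{\hat0\}$ with $k\ge2$. Then the number of chains $d=\{y_0<y_1<\dots<y_k\}$ in $T_t^*$ with $z_t(y_i)=x_i$ for all $i$ is $$|z_t^{-1}(c)|=\prod_{i=2}^{k-1}Z([x_{i-1},x_i])\cdot Z_t([x_{k-1},x_k]).$$
   Context: $T^n=\mathbb{R}^n/\mathbb{Z}^n$. A toric hyperplane is the image of a hyperplane $\{\vec x:\vec a\cdot\vec x=b\}$, $\vec a\in\mathbb{Q}^n\setminus\{0\}$, $b\in\mathbb R$; a toric arrangement is a finite set $\{H_1,\dots,H_m\}$ of them. The intersection poset $\mathcal{P}$ consists of all connected components of all intersections $\bigcap_{i\in S}H_i$ (empty intersection $=T^n$), together with $\emptyset$, ordered by reverse inclusion. $\mathcal{P}\cup\{\hat0\}$ is $\mathcal{P}$ with a new minimum $\hat0$ adjoined below $T^n$; its maximum $\hat1$ is $\emptyset$; ranks are $\rho(\hat0)=0$, $\rho(x)=n-\dim x+1$ for nonempty $x\in\mathcal{P}$, $\rho(\emptyset)=n+2$. $T_t$ is the face poset of the induced cell subdivision of $T^n$: the cells together with the empty face (minimum) and the whole torus (maximum), ordered by $\tau<\sigma$ iff $\tau\subseteq\bar\sigma$; $T_t^*$ is its dual (order reversed). The map $z_t:T_t^*\to\mathcal{P}\cup\{\hat0\}$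 sends the minimum of $T_t^*$ to $\hat0$, the empty face to $\emptyset$, and each cell to the smallest element of $\mathcal{P}$ containing it. For an interval $[x,y]$ with Möbius function $\mu$: $Z([x,y])=\sum_{x\le w\le y}(-1)^{\rho(w)-\rho(x)}\mu(x,w)$ and $Z_t([x,y])=\sum_{w}(-1)^{\rho(w)-\rho(x)}\mu(x,w)$, the latter sum over the coatoms $w$ of $[x,y]$ (elements covered by $y$). *)

(* Defs.v *)
From HB Require Import structures.
From mathcomp Require Import all_boot all_order all_algebra finmap.
From mathcomp Require Import generic_quotient.
From mathcomp Require Import all_classical all_reals all_analysis.

Set Implicit Arguments.
Unset Strict Implicit.
Unset Printing Implicit Defensive.

Import Order.TTheory GRing.Theory Num.Theory.
Import numFieldNormedType.Exports.

Local Open Scope classical_set_scope.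
Local Open Scope ring_scope.

(* A poset is given by a carrier [L : set U] and a relation [le] that is meant
   to be a partial order on [L]. *)
Section Chain.
Variables (U : Type) (L : set U) (le : U -> U -> Prop).

Definition po_strict (x y : U) : Prop := le x y /\ x <> y.

Definition po_chain (k : nat) (c : 'I_k.+1 -> U) : Prop :=
  (forall i, L (c i)) /\
  (forall i j : 'I_k.+1, (i < j)%N -> po_strict (c i) (c j)).

End Chain.

Section Poset.
Variables (U : choiceType) (L : set U) (le : U -> U -> Prop).

Definition po_interval (x y : U) : set U := [set w | [/\ L w, le x w & le w y]].

Definition po_coatoms (x y : U) : set U :=
  [set w | [/\ po_interval x y w, po_strict le w y &
    forall v, L v -> po_strict le w v -> ~ po_strict le v y]].

Definition is_mobius (mu : U -> U -> int) : Prop :=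
  [/\ forall x, L x -> mu x x = 1,
      forall x y, L x -> L y -> po_strict le x y ->
        \sum_(w \in po_interval x y) mu x w = 0
    & forall x y, ~ [/\ L x, L y & le x y] -> mu x y = 0].

(* [is_mobius] determines [mu] as soon as [L] is finite and [le] is a partial
   order on it; see [mobiusP]. *)
Definition mobius : U -> U -> int := xget (fun _ _ => 0) is_mobius.

(* When [rho] is monotone the truncated subtraction is the usual one. *)
Variable rho : U -> nat.

Definition Zsum (x y : U) : int :=
  \sum_(w \in po_interval x y) (-1) ^+ (rho w - rho x) * mobius x w.

Definition Zsum_coatoms (x y : U) : int :=
  \sum_(w \in po_coatoms x y) (-1) ^+ (rho w - rho x) * mobius x w.

End Poset.

Fixpoint mobius_rec (U : choiceType) (L : set U) (le : U -> U -> Prop)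
    (N : nat) (x y : U) : int :=
  if N is N'.+1 then
    if `[< [/\ L x, L y & le x y] >] then
      if `[< x = y >] then 1
      else - \sum_(w \in po_interval L le x y `\ y) mobius_rec L le N' x w
    else 0
  else 0.

Lemma mobiusP (U : choiceType) (L : set U) (le : U -> U -> Prop) :
  finite_set L ->
  (forall x, L x -> le x x) ->
  (forall x y, L x -> L y -> le x y -> le y x -> x = y) ->
  (forall x y z, L x -> L y -> L z -> le x y -> le y z -> le x z) ->
  is_mobius L le (mobius L le) /\
  forall mu, is_mobius L le mu -> mu = mobius L le.
Proof.
move=> finL lexx le_anti le_trans.
have finI x y : finite_set (po_interval L le x y).
  by apply: sub_finite_set finL => w [].
pose c x y : nat := #|` fset_set (po_interval L le x y)|.
have c_lt x y w : L x -> L y -> (po_interval L le x y `\ y) w ->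
    (c x w < c x y)%N.
  move=> Lx Ly [[Lw xw wy] wNy]; apply: fproper_ltn_card.
  rewrite fproperEneq; apply/andP; split; last first.
    by rewrite -fset_set_sub// => v [Lv xv vw]; split=> //; apply: (le_trans v w y).
  apply/eqP => /(fset_set_inj (finI x w) (finI x y)) E.
  have : po_interval L le x y y.
    by split=> //; [apply: (le_trans x w y)|exact: lexx].
  by rewrite -E => -[_ _ yw]; apply: wNy; apply: le_anti.
have c_gt0 x y : [/\ L x, L y & le x y] -> (0 < c x y)%N.
  move=> [Lx Ly xy]; rewrite cardfs_gt0; apply/fset0Pn; exists y.
  by rewrite in_fset_set// inE; split=> //; exact: lexx.
have stab N : forall M x y, (c x y <= N)%N -> (c x y <= M)%N ->
    mobius_rec L le N x y = mobius_rec L le M x y.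
  elim: N => [|N IH] [|M] x y //=.
  - by move=> c0 _; case: asboolP => // /c_gt0; rewrite ltnNge c0.
  - by move=> _ c0; case: asboolP => // /c_gt0; rewrite ltnNge c0.
  move=> cN cM; case: asboolP => // -[Lx Ly xy]; case: asboolP => // _.
  congr (- _); apply: eq_fsbigr => w; rewrite inE => Iw.
  have lt := c_lt x y w Lx Ly Iw.
  by apply: IH; rewrite -ltnS (leq_trans lt).
have ex : is_mobius L le (fun x y => mobius_rec L le (c x y) x y).
  split=> [x Lx|x y Lx Ly [xy xNy]|x y nxy].
  - have /c_gt0 : [/\ L x, L x & le x x] by split=> //; exact: lexx.
    case: (c x x) => //= N _.
    rewrite asboolT; last by split=> //; exact: lexx.
    by rewrite asboolT.
  - have h : [/\ L x, L y & le x y] by [].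
    rewrite (fsbigD1 y)//=; last by split=> //; exact: lexx.
    move: (c_gt0 _ _ h) (fun w => c_lt x y w Lx Ly).
    case E : (c x y) => [//|N] _ lt /=.
    rewrite asboolT// asboolF//.
    rewrite [X in - X](_ : _ =
      \sum_(w \in po_interval L le x y `\ y) mobius_rec L le (c x w) x w).
      by rewrite addNr.
    apply: eq_fsbigr => w; rewrite inE => Iw.
    by apply: stab => //; rewrite -ltnS; apply: lt.
  - by case: (c x y) => //= N; rewrite asboolF.
have uniq mu mu' : is_mobius L le mu -> is_mobius L le mu' -> mu = mu'.
  move=> [m1 m2 m3] [m1' m2' m3'].
  suff E N : forall x y, (c x y <= N)%N -> mu x y = mu' x y.
    by apply/funext => x; apply/funext => y; apply: E (leqnn _).
  elim: N => [|N IH] x y cN.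
    have nxy : ~ [/\ L x, L y & le x y].
      by move=> /c_gt0; rewrite ltnNge cN.
    by rewrite m3// m3'.
  have [h|h] := pselect [/\ L x, L y & le x y]; last by rewrite m3// m3'.
  have [Lx Ly xy] := h.
  have [<-|xNy] := pselect (x = y); first by rewrite m1// m1'.
  have Iy : po_interval L le x y y by split=> //; exact: lexx.
  have := m2 _ _ Lx Ly (conj xy xNy); rewrite (fsbigD1 y)//= => /eqP.
  rewrite addr_eq0 => /eqP ->.
  have := m2' _ _ Lx Ly (conj xy xNy); rewrite (fsbigD1 y)//= => /eqP.
  rewrite addr_eq0 => /eqP ->.
  congr (- _); apply: eq_fsbigr => w; rewrite inE => Iw; apply: IH.
  by rewrite -ltnS (leq_trans (c_lt x y w Lx Ly Iw)).
have mob : is_mobius L le (mobius L le) by apply: xgetPex; eexists; exact: ex.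
by split=> // mu hmu; apply: uniq.
Qed.

Section Torus.
Variables (R : realType) (n : nat).

Definition Zn_congr (x y : 'rV[R]_n) : bool :=
  [forall i, (x 0 i - y 0 i) \is a Num.int].

Lemma Zn_congr_equiv : equiv_class_of Zn_congr.
Proof.
split=> [x|x y|y x z].
- by apply/forallP => i; rewrite subrr.
- by apply/forallP/forallP => h i; rewrite -opprB rpredN.
- move=> /forallP h /forallP h'; apply/forallP => i.
  by rewrite -(subrKA (y 0 i)) rpredD.
Qed.

Canonical Zn_equiv := EquivRelPack Zn_congr_equiv.

Definition torus : topologicalType := quotient_topology {eq_quot Zn_equiv}%qT.

Definition torus_pi (x : 'rV[R]_n) : torus := (\pi_({eq_quot Zn_equiv}) x)%qT.

Lemma torus_piE (x y : 'rV[R]_n) :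
  torus_pi x = torus_pi y <-> forall i, (x 0 i - y 0 i) \is a Num.int.
Proof.
rewrite /torus_pi; split=> [/eqquotP/forallP //|h].
by apply/eqquotP; exact/forallP.
Qed.

Definition toric_hyperplane (h : set torus) : Prop :=
  exists (a : 'rV[rat]_n) (b : R), a != 0 /\
    h = torus_pi @` [set x : 'rV[R]_n | \sum_i ratr (a 0 i) * x 0 i = b].

Definition toric_arrangement (H : set (set torus)) : Prop :=
  finite_set H /\ forall h, H h -> toric_hyperplane h.

(* [X] is the image of a [d]-dimensional affine subspace of [R^n]. *)
Definition affine_image (X : set torus) (d : nat) : Prop :=
  exists (p : 'rV[R]_n) (A : 'M[R]_(d, n)), row_free A /\
    X = torus_pi @` [set p + u *m A | u in [set: 'rV[R]_d]].

Definition torus_dim (X : set torus) : nat := get (affine_image X).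

Definition components (X : topologicalType) (A : set X) : set (set X) :=
  [set connected_component A p | p in A].

Variable H : set (set torus).

Definition int_poset : set (set torus) :=
  [set X | X = set0 \/
     exists S, S `<=` H /\ components (\bigcap_(h in S) h) X].

(* The stratum of [S] consists of the points lying on exactly the members [S]
   of [H]; the open cells of the subdivision are the components of strata. *)
Definition stratum (S : set (set torus)) : set torus :=
  (\bigcap_(h in S) h) `\` (\bigcup_(h in H `\` S) h).

Definition cells : set (set torus) :=
  [set e | exists S, S `<=` H /\ components (stratum S) e].

(* [None] is the adjoined minimum; the maximum is [Some set0]. *)
Definition hat_poset : set (option (set torus)) :=
  [set o | if o is Some X then int_poset X else True].

Definition hat_le (o1 o2 : option (set torus)) : Prop :=
  match o1, o2 with
  | None, _ => True
  | Some X, Some Y => Y `<=` X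
  | Some _, None => False
  end.

Definition hat_rank (o : option (set torus)) : nat :=
  match o with
  | None => 0%N
  | Some X => if X == set0 then n.+2 else (n - torus_dim X).+1
  end.

Inductive face := WholeTorus | Cell of set torus | EmptyFace.

Definition face_poset : set face :=
  [set f | if f is Cell e then cells e else True].

Definition face_le (f1 f2 : face) : Prop :=
  match f1, f2 with
  | EmptyFace, _ => True
  | _, WholeTorus => True
  | Cell t, Cell s => t `<=` closure s
  | _, _ => False
  end.

Definition dual_face_le (f1 f2 : face) : Prop := face_le f2 f1.

Definition is_smallest_containing (e X : set torus) : Prop :=
  [/\ int_poset X, e `<=` X & forall Y, int_poset Y -> e `<=` Y -> X `<=` Y].

Definition zt (f : face) : option (set torus) :=
  match f with
  | WholeTorus => None
  | Cell e => Some (xget set0 (is_smallest_containing e))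
  | EmptyFace => Some set0
  end.

End Torus.

Section CellComplex.
Variables (R : realType) (X : topologicalType).

Definition closed_disk (d : nat) : set 'rV[R]_d :=
  [set u | \sum_i u 0 i ^+ 2 <= 1].

Definition open_disk (d : nat) : set 'rV[R]_d :=
  [set u | \sum_i u 0 i ^+ 2 < 1].

Arguments closed_disk : clear implicits.
Arguments open_disk : clear implicits.

(* The closure of [e] is homeomorphic to the closed [d]-disk by a map carrying
   the interior of the disk onto [e]. *)
Definition regular_cell (d : nat) (e : set X) : Prop :=
  exists (f : 'rV[R]_d -> X) (g : X -> 'rV[R]_d),
    [/\ {within closed_disk d, continuous f},
        {within closure e, continuous g},
        {in closed_disk d, cancel f g},
        f @` closed_disk d = closure e
      & f @` open_disk d = e].

(* A finite regular CW decomposition of [X] with set of open cells [K]. *)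
Definition regular_cell_complex (K : set (set X)) : Prop :=
  [/\ hausdorff_space X, finite_set K, partition K id [set: X] &
    exists dim : set X -> nat, forall e, K e ->
      regular_cell (dim e) e /\
      closure e `\` e `<=` \bigcup_(e' in [set e' | K e' /\ (dim e' < dim e)%N]) e'].

End CellComplex.

(* Main.v *)
Require Import Defs.
From HB Require Import structures.
From mathcomp Require Import all_boot all_order all_algebra finmap.
From mathcomp Require Import generic_quotient.
From mathcomp Require Import all_classical all_reals all_analysis.
From mathcomp Require Import ring lra zify.
Import Order.TTheory GRing.Theory Num.Theory.
Import numFieldNormedType.Exports.
Local Open Scope classical_set_scope.
Local Open Scope ring_scope.
Set Implicit Arguments.
Unset Strict Implicit.
Unset Printing Implicit Defensive.

(** Everything is lifted to [R^n], where the members of [H] become the level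
    sets [ell i x \in Z] of affine forms with integral linear parts, the flats
    become translates of rational subspaces and the cells become convex
    polyhedra.

    Near a point [p] the arrangement is central, and its cells are the
    realizable sign vectors. Slicing a relatively open convex set [C] of
    dimension [d] by hyperplanes leaves the sum of [(-1)^dim] over the pieces
    equal to [(-1)^d]; Moebius inversion of this identity shows that the number
    of sign vectors spanning a flat [X] is [Z([X, supp p])]. Regularity says
    that distinct sign vectors at [p] belong to distinct cells of the torus: the
    point of the closed disk corresponding to [p] has small convex neighbourhoods
    in the open disk, whose connected images cannot straddle a hyperplane.

    For the last factor, choose a linear functional [nu] that is nonconstant on
    every flat of positive dimension. Each cell then has a unique lowest vertex,
    so the cells with support [X] correspond to pairs of a vertex [p] and a sign
    vector at [p] on whose cone [nu >= 0]. Subtracting the identity above for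
    [C = X /\ {nu < 0}] from the one for [C = X] shows that the signed number of
    these sign vectors, summed over the flats between [X] and [p], is [1] if
    [X = p] and [0] otherwise, so that their number is [|mu(X, p)|]. *)

(** * Euler characteristic of a sliced convex set *)

Section Linear.
Variables (R : realFieldType) (n : nat).
Implicit Types (u v w : 'rV[R]_n) (f : 'cV[R]_n) (V : 'M[R]_n).

Definition ev f u : R := (u *m f) 0 0.

Lemma evD f u v : ev f (u + v) = ev f u + ev f v.
Proof. by rewrite /ev mulmxDl mxE. Qed.
Lemma evN f u : ev f (- u) = - ev f u.
Proof. by rewrite /ev mulNmx mxE. Qed.
Lemma evB f u v : ev f (u - v) = ev f u - ev f v.
Proof. by rewrite evD evN. Qed.
Lemma evZ f t u : ev f (t *: u) = t * ev f u.
Proof. by rewrite /ev -scalemxAl mxE. Qed.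
Lemma ev0 f : ev f 0 = 0.
Proof. by rewrite /ev mul0mx mxE. Qed.
Definition evE := (evD, evN, evZ, ev0).

Lemma ev_eq0 f u : (u <= kermx f)%MS = (ev f u == 0).
Proof.
apply/sub_kermxP/eqP => [h|h]; first by rewrite /ev h mxE.
by apply/matrixP => i j; rewrite !ord1 [LHS]h mxE.
Qed.

Lemma ev_neq0P f V : V *m f != 0 -> exists2 v, (v <= V)%MS & ev f v != 0.
Proof.
move=> /eqP Vf; apply: contrapT => h; apply: Vf; apply/row_matrixP => i.
rewrite row_mul row0; apply/eqP; rewrite -sub_kermx ev_eq0.
by apply/negPn/negP => hi; apply: h; exists (row i V) => //; exact: row_sub.
Qed.

(** [None] stands for zero. A finite type of signs makes the sign vectors a finite type, over which
    sums can be taken. *)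
Definition sgb (x : R) : option bool := if x == 0 then None else Some (0 < x).

Lemma sgb_None x : (sgb x == None) = (x == 0).
Proof. by rewrite /sgb; case: (x == 0). Qed.
Lemma sgb_true x : (sgb x == Some true) = (0 < x).
Proof. by rewrite /sgb; case: ltrgt0P. Qed.
Lemma sgb_false x : (sgb x == Some false) = (x < 0).
Proof. by rewrite /sgb; case: ltrgt0P. Qed.

Lemma sgb_mulr t x : 0 < t -> sgb (t * x) = sgb x.
Proof. by move=> t0; rewrite /sgb mulf_eq0 gt_eqF//= pmulr_rgt0. Qed.

(* Relative openness is only required along rays, which is what cutting by a
   hyperplane preserves most easily. *)
Definition rel_open_convex V (C : set 'rV[R]_n) : Prop :=
  [/\ forall c, C c -> (c <= V)%MS,
      forall c v, C c -> (v <= V)%MS ->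
        exists2 e : R, 0 < e & forall t, 0 <= t < e -> C (c + t *: v)
    & forall c d t, C c -> C d -> 0 <= t <= 1 -> C (c + t *: (d - c))].

Lemma rel_open_convex_full V : rel_open_convex V [set u | (u <= V)%MS].
Proof.
split=> //= [c v Cc Vv|c d t Cc Cd _].
  by exists 1 => // t _; rewrite addmx_sub// scalemx_sub.
by rewrite addmx_sub// scalemx_sub// addmx_sub// eqmx_opp.
Qed.

Lemma small_perturb (x y : R) : 0 < x ->
  exists2 e : R, 0 < e & forall t, 0 <= t < e -> 0 < x + t * y.
Proof.
move=> x0; have y1 : 0 < `|y| + 1 by rewrite ltr_wpDl.
exists (x / (`|y| + 1)); first exact: divr_gt0.
move=> t /andP[t0]; rewrite ltr_pdivlMr// mulrDr mulr1 => tx.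
have : t * - `|y| <= t * y by rewrite ler_wpM2l// lerNl ler_normr lexx orbT.
by rewrite mulrN; lra.
Qed.

Lemma rel_open_convex_pos V C f : rel_open_convex V C ->
  rel_open_convex V (C `&` [set u | 0 < ev f u]).
Proof.
move=> [CV Co Cc]; split=> [c [/CV]//|c v [Cc1 /= fc] Vv|c d t [C1 /= f1] [C2 /= f2] t01].
  have [e e0 he] := Co _ _ Cc1 Vv.
  have [e' e'0 he'] := @small_perturb _ (ev f v) fc.
  exists (Num.min e e'); first by rewrite lt_min e0.
  move=> t /andP[t0]; rewrite lt_min => /andP[te te'].
  split; first by apply: he; rewrite t0.
  by rewrite /= evD evZ; apply: he'; rewrite t0.
split; first exact: Cc.
rewrite /= evD evZ evB; case/andP: t01 => t0 t1.
have [->|tN] := eqVneq t 0; first by rewrite mul0r addr0.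
have tp : 0 < t by rewrite lt_neqAle eq_sym tN.
have : 0 < t * ev f d by exact: mulr_gt0.
have : 0 <= (1 - t) * ev f c by rewrite mulr_ge0 ?subr_ge0// ltW.
lra.
Qed.

Lemma ev_opp f u : ev (- f) u = - ev f u.
Proof. by rewrite /ev mulmxN mxE. Qed.

Lemma rel_open_convex_neg V C f : rel_open_convex V C ->
  rel_open_convex V (C `&` [set u | ev f u < 0]).
Proof.
move=> /(@rel_open_convex_pos _ _ (- f)).
by congr rel_open_convex; congr (_ `&` _); apply/seteqP; split=> u /=;
  rewrite ev_opp oppr_gt0.
Qed.

Lemma rel_open_convex_zero V C f : rel_open_convex V C ->
  rel_open_convex (V :&: kermx f)%MS (C `&` [set u | ev f u = 0]).
Proof.
move=> [CV Co Cc]; split=> [c [/CV h /= fc]|c v [Cc1 /= fc]|c d t [C1 /= f1] [C2 /= f2] t01].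
- by rewrite sub_capmx h ev_eq0 fc eqxx.
- rewrite sub_capmx ev_eq0 => /andP[Vv /eqP fv].
  have [e e0 he] := Co _ _ Cc1 Vv; exists e => // t te; split; first exact: he.
  by rewrite /= !evE fc fv mulr0 addr0.
- by split; [exact: Cc|rewrite /= !evE f1 f2; lra].
Qed.

Lemma ev_straddle C f c d : (forall t, 0 <= t <= 1 -> C (c + t *: (d - c))) ->
  0 < ev f c -> ev f d < 0 -> exists2 u, C u & ev f u = 0.
Proof.
move=> Cc fc fd; have cd : 0 < ev f c - ev f d by rewrite subr_gt0 (lt_trans fd).
exists (c + (ev f c / (ev f c - ev f d)) *: (d - c)).
  apply: Cc; rewrite divr_ge0 ?(ltW fc) ?(ltW cd)//=.
  by rewrite ler_pdivrMr// mul1r lerBrDl gerDr ltW.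
rewrite !evE; set a := ev f c in cd *; set b := ev f d in cd *.
have -> : b - a = - (a - b) by rewrite opprB.
by rewrite mulrN divfK ?gt_eqF// subrr.
Qed.

Lemma rank_cap_ker V f : V *m f != 0 -> (\rank (V :&: kermx f)%MS).+1 = \rank V.
Proof.
move=> Vf; rewrite -(mxrank_mul_ker V f) -add1n; congr (_ + _)%N.
apply/eqP; rewrite eqn_leq lt0n mxrank_eq0 Vf andTb.
exact: rank_leq_col.
Qed.

(* A hyperplane that cuts [C] properly replaces [(-1)^d] by
   [(-1)^d + (-1)^d + (-1)^(d-1)], where [d = \rank V]. *)
Lemma euler_cells m (fs : 'I_m -> 'cV[R]_n) V C :
  rel_open_convex V C -> C !=set0 ->
  \sum_(s : {ffun 'I_m -> option bool} |
        `[< exists2 u, C u & forall i, sgb (ev (fs i) u) = s i >])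
     (-1) ^+ \rank (V :&: \bigcap_(i | s i == None) kermx (fs i))%MS
  = (-1) ^+ \rank V :> int.
Proof.
elim: m fs V C => [|m IH] fs V C hC [c0 Cc0].
  rewrite (big_pred1 [ffun=> None]) => [|s]; last first.
    rewrite [RHS](_ : _ = true); last by apply/eqP/ffunP => -[].
    by apply/asboolP; exists c0 => // -[].
  by rewrite big_ord0 capmx1.
(* A sign vector splits into its sign at the first form and a sign vector for the remaining
   forms. *)
pose h (q : option bool * {ffun 'I_m -> option bool}) : {ffun 'I_m.+1 -> option bool} :=
  [ffun i => if unlift ord0 i is Some j then q.2 j else q.1].
have h0 q : h q ord0 = q.1 by rewrite ffunE unlift_none.
have hS q j : h q (lift ord0 j) = q.2 j by rewrite ffunE liftK.
have hbij : bijective h.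
  exists (fun s : {ffun _ -> _} => (s ord0, [ffun j => s (lift ord0 j)])) => [[b s]|s] /=.
    by rewrite h0; congr pair; apply/ffunP => j; rewrite ffunE hS.
  by apply/ffunP => i; case: (unliftP ord0 i) => [j|] ->; rewrite ?h0 ?hS ?ffunE.
pose f0 := fs ord0; pose fs' (j : 'I_m) := fs (lift ord0 j).
(* [D b] is the piece of [C] with sign [b] at the first form, and [W b] is the subspace in which it
   is relatively open. *)
pose W (b : option bool) := if b is None then (V :&: kermx f0)%MS else V.
pose D b := C `&` [set u | sgb (ev f0 u) = b].
rewrite (reindex h) /=; last exact: onW_bij.
have -> : \sum_(j | `[< exists2 u, C u & forall i, sgb (ev (fs i) u) = h j i >])
     (-1) ^+ \rank (V :&: \bigcap_(i | h j i == None) kermx (fs i))%MS =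
   \sum_(b : option bool) \sum_(s : {ffun 'I_m -> option bool} |
        `[< exists2 u, D b u & forall i, sgb (ev (fs' i) u) = s i >])
     (-1) ^+ \rank (W b :&: \bigcap_(i | s i == None) kermx (fs' i))%MS :> int.
  rewrite pair_big_dep /=; apply: eq_big => [[b s]|[b s] _] /=.
    apply/asboolP/asboolP => -[u].
      move=> Cu hu; exists u; last by move=> i; rewrite hu hS.
      by split=> //=; rewrite hu h0.
    move=> [Cu /= fu] hu; exists u => // i.
    by case: (unliftP ord0 i) => [j|] ->; rewrite ?hS ?h0 ?hu ?fu.
  congr (_ ^+ \rank _); rewrite big_mkcond big_ord_recl h0 /=.
  rewrite [in RHS]big_mkcond /=.
  under eq_bigr do rewrite hS.
  by case: b => [b|] /=; [rewrite cap1mx|rewrite capmxA].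
have hD b : rel_open_convex (W b) (D b).
  case: b => [[]|]; rewrite /D /W.
  - rewrite (_ : [set _ | _] = [set u | 0 < ev f0 u]); first exact: rel_open_convex_pos.
    by apply/seteqP; split=> u /=; rewrite -sgb_true => /eqP.
  - rewrite (_ : [set _ | _] = [set u | ev f0 u < 0]); first exact: rel_open_convex_neg.
    by apply/seteqP; split=> u /=; rewrite -sgb_false => /eqP.
  - rewrite (_ : [set _ | _] = [set u | ev f0 u = 0]); first exact: rel_open_convex_zero.
    by apply/seteqP; split=> u /= /eqP; rewrite ?sgb_None => /eqP // /eqP; rewrite -sgb_None => /eqP.
have Tne b : D b !=set0 -> \sum_(s : {ffun 'I_m -> option bool} |
        `[< exists2 u, D b u & forall i, sgb (ev (fs' i) u) = s i >])
     (-1) ^+ \rank (W b :&: \bigcap_(i | s i == None) kermx (fs' i))%MS =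
     (-1) ^+ \rank (W b) :> int by move=> D0; exact: IH.
have T0 b : ~ (D b !=set0) -> \sum_(s : {ffun 'I_m -> option bool} |
        `[< exists2 u, D b u & forall i, sgb (ev (fs' i) u) = s i >])
     (-1) ^+ \rank (W b :&: \bigcap_(i | s i == None) kermx (fs' i))%MS = 0 :> int.
  move=> D0; apply: big_pred0 => s; apply/asboolP => -[u Du _].
  by apply: D0; exists u.
rewrite (bigD1 None) //= (bigD1 (Some true)) //= (bigD1 (Some false)) //=.
rewrite [X in _ + (_ + (_ + X))]big1 ?addr0; last by case=> [[]|].
have [CV Co Cc] := hC.
(* If the form vanishes on [V], only the zero piece is nonempty. Otherwise either the hyperplane
   meets [C] and all three pieces are nonempty, or it misses [C], which by convexity lies on one
   side. *)
have [Vf|Vf] := eqVneq (V *m f0) 0.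
  have C0 u : C u -> ev f0 u = 0.
    by move/CV => /submxP[w ->]; rewrite /ev -mulmxA Vf mulmx0 mxE.
  rewrite Tne; last by exists c0; split=> //=; rewrite /sgb C0 ?eqxx.
  rewrite !T0 ?addr0.
  - by rewrite /W; have /capmx_idPl -> : (V <= kermx f0)%MS by apply/sub_kermxP.
  - by move=> [u [/C0 /= fu]]; rewrite /sgb fu eqxx.
  - by move=> [u [/C0 /= fu]]; rewrite /sgb fu eqxx.
have [[c [Cc1 fc]]|D0] := pselect (D None !=set0).
  have {}fc : ev f0 c = 0 by apply/eqP; rewrite -sgb_None /= fc.
  have [w Vw fw] := ev_neq0P Vf.
  have dir v : (v <= V)%MS -> ev f0 v != 0 -> D (sgb (ev f0 v)) !=set0.
    move=> Vv _; have [e e0 he] := Co _ _ Cc1 Vv.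
    exists (c + (e / 2) *: v); split; first by apply: he; lra.
    by rewrite /= evD fc add0r evZ sgb_mulr// divr_gt0.
  have wlog_pos : exists v, [/\ (v <= V)%MS & 0 < ev f0 v].
    have [fwp|fwn] := ltP 0 (ev f0 w); first by exists w.
    exists (- w); rewrite eqmx_opp; split=> //.
    by rewrite evN oppr_gt0 lt_neqAle fw.
  have [v [Vv fv]] := wlog_pos.
  rewrite !Tne.
  - rewrite /W -(rank_cap_ker Vf) exprS mulN1r; set q := (-1) ^+ _.
    by rewrite addrA subrr add0r.
  - have := dir (- v); rewrite eqmx_opp evN oppr_eq0 gt_eqF// => /(_ Vv isT).
    by have /eqP -> : sgb (- ev f0 v) == Some false by rewrite sgb_false oppr_lt0.
  - have := dir v Vv; rewrite gt_eqF// => /(_ isT).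
    by have /eqP -> : sgb (ev f0 v) == Some true by rewrite sgb_true.
  - by exists c; split=> //=; rewrite /sgb fc eqxx.
rewrite (T0 _ D0) add0r.
have noz u : C u -> ev f0 u != 0.
  by move=> Cu; apply/eqP => fu; apply: D0; exists u; split=> //=; rewrite /sgb fu eqxx.
have excl : ~ (D (Some true) !=set0 /\ D (Some false) !=set0).
  move=> [[c [Cc1 /= /eqP fc]] [d [Cd /= /eqP fd]]].
  rewrite sgb_true in fc; rewrite sgb_false in fd.
  have [u Cu fu] : exists2 u, C u & ev f0 u = 0.
    by apply: ev_straddle fc fd => t ht; exact: Cc.
  by have := noz _ Cu; rewrite fu eqxx.
have [fp|fn] := ltP 0 (ev f0 c0).
  have Dt : D (Some true) !=set0.
    by exists c0; split=> //=; apply/eqP; rewrite sgb_true.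
  by rewrite Tne// T0 ?addr0// => Df; apply: excl.
have Df : D (Some false) !=set0.
  by exists c0; split=> //=; apply/eqP; rewrite sgb_false lt_neqAle noz.
by rewrite T0 ?add0r ?Tne// => Dt; apply: excl.
Qed.
End Linear.

(** * Moebius inversion and counting *)

Section Mobius.
Variables (U : choiceType) (L : set U) (le : U -> U -> Prop).
Hypothesis finL : finite_set L.
Hypothesis lexx : forall x, L x -> le x x.
Hypothesis le_anti : forall x y, L x -> L y -> le x y -> le y x -> x = y.
Hypothesis le_trans : forall x y z, L x -> L y -> L z -> le x y -> le y z -> le x z.

Lemma mobius_sum x y : L x -> L y ->
  \sum_(w \in po_interval L le x y) mobius L le x w = (x == y)%:R.
Proof.
move=> Lx Ly; have [[m1 m2 m3] _] := mobiusP finL lexx le_anti le_trans.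
have [<-|xNy] := eqVneq x y.
  rewrite (_ : po_interval L le x x = [set x]) ?fsbig_set1 ?m1//.
  apply/seteqP; split=> [w [Lw xw wx]|w ->] /=; first exact: le_anti.
  by split=> //; exact: lexx.
have [xy|nxy] := pselect (le x y); first by rewrite m2//; split=> //; apply/eqP.
rewrite (_ : po_interval L le x y = set0) ?fsbig_set0//.
by apply/seteqP; split=> // w [Lw xw wy]; apply: nxy; apply: (le_trans (y := w)).
Qed.

(** Exchanging the sums leaves, for each [s], the sum of the Moebius function over the interval from
    [X] to [F s], which is 1 if [F s] equals [X] and 0 otherwise. The bound [le (F s) Y] keeps this
    interval inside the one from [X] to [Y]. *)
Lemma mobius_inversion (I : finType) (Q : pred I) (F : I -> U) (wt : I -> int)
    (X Y : U) (g : U -> int) : L X -> L Y ->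
  (forall s, Q s -> L (F s) /\ le (F s) Y) ->
  (forall Z, po_interval L le X Y Z ->
     \sum_(s | Q s && `[< le Z (F s) >]) wt s = g Z) ->
  \sum_(Z \in po_interval L le X Y) mobius L le X Z * g Z =
  \sum_(s | Q s && (F s == X)) wt s.
Proof.
move=> LX LY QF gE.
have finI x y : finite_set (po_interval L le x y).
  by apply: sub_finite_set finL => w [].
transitivity (\sum_(Z \in po_interval L le X Y) \sum_(s | Q s)
    (if `[< le Z (F s) >] then mobius L le X Z * wt s else 0)).
  apply: eq_fsbigr => Z; rewrite inE => IZ; rewrite -gE// mulr_sumr.
  by rewrite big_mkcondr.
rewrite fsbig_finite//= exchange_big/= [RHS]big_mkcondr/=.
apply: eq_bigr => s Qs; have [LF FY] := QF _ Qs.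
transitivity (wt s * \sum_(Z \in po_interval L le X (F s)) mobius L le X Z).
  rewrite mulr_fsumr (_ : po_interval L le X (F s) =
     po_interval L le X Y `&` [set Z | le Z (F s)]).
    rewrite fsbig_mkcondr fsbig_finite//; apply: eq_bigr => Z _.
    by case: asboolP => h; [rewrite mem_set// mulrC|rewrite memNset].
  apply/seteqP; split=> [Z [LZ XZ ZF]|Z [[LZ XZ ZY] ZF]]; split=> //.
  by split=> //; apply: (le_trans (y := F s)).
rewrite mobius_sum// eq_sym; case: eqP => _; by rewrite ?mulr1 ?mulr0.
Qed.

End Mobius.

(** * Cardinalities of parametrized and fibred sets *)

Section Counting.

(** Converts a parametrization of cells by sign vectors into the integer sum that Moebius inversion
    evaluates. *)
Lemma card_indexed_bij (U T : choiceType) (I : finType) (B : set U)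
    (Q : U -> pred I) (A : set T) (f : U -> I -> T) :
  finite_set B ->
  (forall w s, B w -> Q w s -> A (f w s)) ->
  (forall w s w' s', B w -> Q w s -> B w' -> Q w' s' -> f w s = f w' s' ->
     w = w' /\ s = s') ->
  (forall a, A a -> exists w s, [/\ B w, Q w s & f w s = a]) ->
  exists N : nat, (A #= `I_N)%card /\
    N%:Z = \sum_(w \in B) \sum_(s | Q w s) (1 : int).
Proof.
move=> finB fA finj fsurj.
pose D := [set q : U * I | B q.1 /\ Q q.1 q.2].
have finD : finite_set D.
  apply: (@sub_finite_set _ _ (B `*` [set: I])); first by move=> q [].
  by apply: finite_setX => //; exact: finite_finset.
exists #|` fset_set D|; split.
  have -> : A = (fun q => f q.1 q.2) @` D.
    apply/seteqP; split=> [a /fsurj [w [s [Bw Qs <-]]]|a [[w s] [/= Bw Qs] <-]].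
      by exists (w, s).
    exact: fA.
  apply: (@card_eq_trans _ _ _ _ D); last first.
    by rewrite -{1}(fset_setK finD); apply/card_eq_fsetP.
  apply: inj_card_eq => -[w s] [w' s']; rewrite !inE => -[/= Bw Qs] [/= Bw' Qs'] h.
  by have [-> ->] := finj _ _ _ _ Bw Qs Bw' Qs' h.
transitivity (\sum_(q \in D) (1 : int)).
  rewrite fsbig_finite// big_const_seq count_predT.
  by elim: (size _) => //= k <-; rewrite intS.
transitivity (\sum_(q \in B `*` [set: I]) (if Q q.1 q.2 then 1 else 0 : int)).
  rewrite (_ : D = (B `*` [set: I]) `&` [set q | Q q.1 q.2]).
    by rewrite fsbig_mkcondr; apply: eq_fsbigr => q _; rewrite mem_setE.
  by apply/seteqP; split=> [q [? ?]|q [[? _] ?]].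
rewrite -(@pair_fsbig _ _ _ _ _ _ _ (fun w s => if Q w s then 1 else 0 : int))//; last exact: finite_finset.
apply: eq_fsbigr => w _; rewrite [RHS]big_mkcond/=.
rewrite (_ : [set: I] = [set` enum I]); last first.
  by apply/seteqP; split=> s //= _; rewrite mem_enum.
by rewrite -fsbig_seq ?enum_uniq// big_enum.
Qed.

Lemma card_fibers (T U : Type) (A : set T) (B : set U) (f : T -> U) (N c : nat) :
  (forall a, A a -> B (f a)) -> (B #= `I_N)%card ->
  (forall b, B b -> (A `&` f @^-1` [set b] #= `I_c)%card) ->
  (A #= `I_(N * c))%card.
Proof.
move=> fAB /card_set_bijP[g [gB ginj gsurj]] hfib.
have /choice[h hP] : forall b, exists h : T -> nat, B b ->
    set_bij (A `&` f @^-1` [set b]) `I_c h.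
  move=> b; have [Bb|nB] := pselect (B b); last by exists (fun=> 0%N).
  by have /card_set_bijP[h hh] := hfib _ Bb; exists h.
(* The index of the fibre and the index within the fibre are the quotient and the remainder of one
   number modulo [c]. *)
apply/card_set_bijP; exists (fun a => g (f a) * c + h (f a) a)%N; split.
- move=> a Aa /=; have := gB _ (fAB _ Aa); have [hB _ _] := hP _ (fAB _ Aa).
  have /= := hB a (conj Aa erefl); nia.
- move=> a a'; rewrite !inE => Aa Aa' E.
  have [hB hinj _] := hP _ (fAB _ Aa); have [hB' _ _] := hP _ (fAB _ Aa').
  have /= h1 := hB a (conj Aa erefl); have /= h2 := hB' a' (conj Aa' erefl).
  have E1 : g (f a) = g (f a') by nia.
  have {}E1 : f a = f a' by apply: ginj E1; rewrite inE; exact: fAB.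
  apply: hinj; rewrite ?inE//; rewrite -E1 in E h2; lia.
- move=> j /= jN; have c0 : (0 < c)%N by lia.
  have [b Bb gb] := gsurj (j %/ c)%N (ltac:(rewrite /= ltn_divLR//)).
  have [_ _ hsurj] := hP _ Bb.
  have [a [Aa /= fa] ha] := hsurj (j %% c)%N (ltac:(rewrite /= ltn_mod//)).
  by exists a => //=; rewrite fa gb ha -divn_eq.
Qed.

(** The number of continuations depends only on the level, which gives the product. Padding with
    [e0] lets one type of functions on [nat] serve every length in the induction. *)
Lemma card_sequences (E : Type) (e0 : E) (B : nat -> set E)
    (r : E -> E -> Prop) (c : nat -> nat) (j : nat) :
  (B 0%N #= `I_(c 0%N))%card ->
  (forall i b, (i < j)%N -> B i b ->
     ([set b' | B i.+1 b' /\ r b' b] #= `I_(c i.+1))%card) ->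
  ([set y : nat -> E | [/\ forall i, (i <= j)%N -> B i (y i),
      forall i, (i < j)%N -> r (y i.+1) (y i)
    & forall i, (j < i)%N -> y i = e0]] #= `I_(\prod_(i < j.+1) c i))%card.
Proof.
move=> B0; elim: j => [|j IH] hB.
  rewrite big_ord_recl big_ord0 muln1 /=.
  apply: card_eq_trans B0.
  rewrite (_ : [set y | _] = (fun b i => if i is 0%N then b else e0) @` B 0%N).
    by apply: inj_card_eq => b b' _ _ /(congr1 (@^~ 0%N)).
  apply/seteqP; split=> [y [h1 _ h3]|_ [b Bb <-]] /=.
    exists (y 0%N); first exact: h1.
    by apply/funext => -[|i]//; rewrite h3.
  by split=> // [[]//|[]//].
rewrite big_ord_recr /=.
pose cut (y : nat -> E) i := if (i <= j)%N then y i else e0.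
apply: (card_fibers (f := cut)) (IH _) _ => [y [h1 h2 _]|i b ij|y [h1 h2 h3]].
- split=> i ij; rewrite /cut.
  + by rewrite ij; apply: h1; lia.
  + by rewrite ij (ltnW ij); apply: h2; lia.
  + by rewrite leqNgt ij.
- by apply: hB; lia.
have Byj : B j (y j) by exact: h1.
apply: card_eq_trans (hB j _ (ltnSn _) Byj).
rewrite (_ : _ `&` _ = (fun b i => if i == j.+1 then b else y i) @`
   [set b' | B j.+1 b' /\ r b' (y j)]).
  by apply: inj_card_eq => b b' _ _ /(congr1 (@^~ j.+1)); rewrite eqxx.
apply/seteqP; split=> [z [[z1 z2 z3] /= <-]|_ [b [Bb rb] <-]] /=.
  exists (z j.+1).
    by split; [exact: z1|rewrite /cut leqnn; exact: z2].
  apply/funext => i; rewrite /cut; case: eqP => [->//|/eqP ij].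
  case: ifP => // ij'; rewrite z3//; lia.
split; last first.
  apply/funext => i; rewrite /cut; case: leqP => ij; last by rewrite h3.
  by rewrite ltn_eqF.
split=> i ij.
- case: eqP => [->//|/eqP ij']; apply: h1; lia.
- rewrite (ltn_eqF ij) eqSS; case: eqP => [->//|/eqP ij']; apply: h2; lia.
- by rewrite gtn_eqF// h3//; lia.
Qed.

End Counting.

(** * The quotient map onto the torus *)

Section TorusTopology.
Variables (R : realType) (n : nat).
Implicit Types (x y z u : 'rV[R]_n) (f : 'cV[R]_n).
Local Notation torus := (torus R n).
Local Notation torus_pi := (@torus_pi R n).

Lemma torus_pi_surj (q : torus) : exists x, torus_pi x = q.
Proof. by exists (repr q); exact: reprK. Qed.

Lemma torus_pi_continuous : continuous torus_pi.
Proof. exact: pi_continuous. Qed.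

Lemma torus_pi_add_int x z : (forall i, z 0 i \is a Num.int) ->
  torus_pi (x + z) = torus_pi x.
Proof. by move=> hz; apply/torus_piE => i; rewrite mxE addrAC subrr add0r. Qed.

Lemma torus_pi_eqP x y : torus_pi x = torus_pi y ->
  exists2 z : 'rV[R]_n, (forall i, z 0 i \is a Num.int) & y = x + z.
Proof.
move/torus_piE => h; exists (y - x); last by rewrite addrC subrK.
by move=> i; rewrite !mxE -opprB rpredN.
Qed.

Lemma nbhs_translate x z (U : set 'rV[R]_n) :
  nbhs (x + z) U -> nbhs x [set y | U (y + z)].
Proof.
move=> hU; have : (y + z) @[y --> x] --> x + z.
  by apply: (cvgD (F := nbhs x)); [exact: cvg_id|exact: cvg_cst].
exact.
Qed.

(** The preimage of the image of [U] is the union of the integral translates of [U]. *)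
Lemma torus_pi_open (U : set 'rV[R]_n) : open U -> open (torus_pi @` U).
Proof.
move=> oU; rewrite /open /= /quotient_open.
rewrite openE => x [y Uy /torus_pi_eqP[z hz xE]].
have : nbhs (x + - z) U by apply: open_nbhs_nbhs; rewrite xE addrK.
move=> /nbhs_translate; apply: filterS => w Uw; exists (w - z) => //.
by apply: torus_pi_add_int => i; rewrite mxE rpredN.
Qed.

Lemma torus_pi_nbhs x (U : set 'rV[R]_n) :
  nbhs x U -> nbhs (torus_pi x) (torus_pi @` U).
Proof.
move=> hU; have : nbhs (torus_pi x) (torus_pi @` interior U).
  apply: open_nbhs_nbhs; split; first by apply: torus_pi_open; exact: open_interior.
  by exists x.
by apply: filterS; apply: image_subset; exact: interior_subset.
Qed.

Lemma closure_torusP (e : set torus) x :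
  closure e (torus_pi x) <->
  forall U, nbhs x U -> exists2 y, U y & e (torus_pi y).
Proof.
split=> [h U /torus_pi_nbhs /h [q [eq [y Uy yq]]]|h B].
  by exists y => //; rewrite yq.
by move=> /torus_pi_continuous /h [y By ey]; exists (torus_pi y).
Qed.

Lemma ev_continuous f : continuous (ev f).
Proof.
have -> : ev f = fun x => \sum_j x 0 j * f j 0.
  by apply/funext => x; rewrite /ev mxE.
elim: (index_enum _) => [|j r IH].
  under eq_fun do rewrite big_nil. by apply: cst_continuous.
under eq_fun do rewrite big_cons.
move=> x; apply: (cvgD (F := nbhs x)); last exact: IH.
by apply: (cvgM (F := nbhs x)); [exact: coord_continuous|exact: cvg_cst].
Qed.

Lemma open_ev_gt f (c : R) : open [set w : 'rV[R]_n | c < ev f w].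
Proof.
have /continuousP h := @ev_continuous f.
exact: (h [set t | c < t] (@open_gt _ c)).
Qed.

Lemma open_ev_lt f (c : R) : open [set w : 'rV[R]_n | ev f w < c].
Proof.
have /continuousP h := @ev_continuous f.
exact: (h [set t | t < c] (@open_lt _ c)).
Qed.

Lemma nbhs_ray x u (U : set 'rV[R]_n) : nbhs x U ->
  exists2 e : R, 0 < e & forall t, 0 <= t < e -> U (x + t *: u).
Proof.
move=> hU; have c : (x + t *: u) @[t --> (0:R)] --> x.
  rewrite -[X in _ --> X](addr0 x) -[X in _ + X](scale0r u).
  by apply: cvgD; [exact: cvg_cst|apply: cvgZr_tmp; exact: cvg_id].
have /nbhs_ballP[e /= e0 he] := c _ hU; exists e => // t /andP[t0 te].
by apply: he; rewrite /ball /= sub0r normrN ger0_norm.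
Qed.

Lemma convex_connected (C : set 'rV[R]_n) :
  (forall c d (t : R), C c -> C d -> 0 <= t <= 1 -> C (c + t *: (d - c))) ->
  connected C.
Proof.
move=> Cc; have [[c Cc0]|/nonemptyPn->] := pselect (C !=set0); last exact: connected0.
pose seg d := (fun t : R => c + t *: (d - c)) @` `[0, 1]%classic.
have -> : C = \bigcup_(d in C) seg d.
  apply/seteqP; split=> [d Cd|_ [d Cd [t /= t01 <-]]].
    exists d => //; exists 1 => /=; first by rewrite in_itv/= ler01 lexx.
    by rewrite scale1r addrC subrK.
  by apply: Cc => //; rewrite in_itv/= in t01.
apply: bigcup_connected.
  exists c => d Cd; exists 0 => /=; first by rewrite in_itv/= lexx ler01.
  by rewrite scale0r addr0.
move=> d Cd; apply: connected_continuous_connected; first exact: segment_connected.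
apply: continuous_subspaceT => t.
by apply: cvgD; [exact: cvg_cst|apply: cvgZr_tmp; exact: cvg_id].
Qed.

(** The local condition makes [X] both open and closed in [A], and a nonempty connected subset with
    this property is a component. *)
Lemma connected_componentE (A X : set torus) p :
  X `<=` A -> connected X -> X p ->
  (forall x, A (torus_pi x) -> \forall y \near x,
     A (torus_pi y) -> (X (torus_pi y) <-> X (torus_pi x))) ->
  connected_component A p = X.
Proof.
move=> XA cX Xp loc; apply/seteqP; split; last exact: connected_component_max.
pose O := torus_pi @` (interior [set y | A (torus_pi y) -> X (torus_pi y)]).
pose O' := torus_pi @` (interior [set y | A (torus_pi y) -> ~ X (torus_pi y)]).
have oO : open O by apply: torus_pi_open; exact: open_interior.
have oO' : open O' by apply: torus_pi_open; exact: open_interior.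
have OX q : A q -> (O q <-> X q).
  move=> Aq; split=> [[y yO yq]|Xq].
    by move: Aq; rewrite -yq; apply: (interior_subset yO).
  have [x xq] := torus_pi_surj q; exists x => //; rewrite -xq in Aq Xq.
  by apply: filterS (loc x Aq) => y h Ay; apply/h.
have O'X q : A q -> (O' q <-> ~ X q).
  move=> Aq; split=> [[y yO yq]|Xq].
    by move: Aq; rewrite -yq; apply: (interior_subset yO).
  have [x xq] := torus_pi_surj q; exists x => //; rewrite -xq in Aq Xq.
  by apply: filterS (loc x Aq) => y h Ay Xy; apply: Xq; apply/(h Ay).
set C := connected_component A p.
have CA : C `<=` A by exact: connected_component_sub.
suff h : C `&` X = C by rewrite -h => q [].
apply: component_connected.
- by exists p; split=> //; apply: connected_component_refl; exact: XA.
- exists O => //; apply/seteqP; split=> q [Cq h]; split=> //.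
    by apply/OX => //; exact: CA.
  by apply/(OX q (CA _ Cq)).
- exists (~` O'); first exact: open_closedC.
  apply/seteqP; split=> q [Cq h]; split=> //.
    by move=> /(O'X q (CA _ Cq)).
  by apply: contrapT => nX; apply: h; apply/(O'X q (CA _ Cq)).
Qed.

(** An injective choice of [z] would make the unit interval countable, hence of Lebesgue measure
    0. *)
Lemma uncountable_pigeonhole (P : R -> 'rV[int]_n -> Prop) :
  (forall t, exists z : 'rV[int]_n, P t z) ->
  exists t t' (z : 'rV[int]_n), [/\ t != t', P t z & P t' z].
Proof.
move=> /choice[g gP]; apply: contrapT => h.
have ginj : injective g.
  move=> t t' E; apply/eqP/negPn/negP => tt'; apply: h.
  by exists t, t', (g t); split=> //; rewrite E.
have cR : countable `[0 : R, 1]%classic.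
  apply: (@sub_countable _ _ _ (g @` `[0 : R, 1]%classic)); last exact: countableP.
  have : (g @` `[0 : R, 1]%classic #= `[0 : R, 1]%classic)%card.
    by apply: inj_card_eq => t t' _ _ /ginj.
  by rewrite card_eq_le => /andP[].
have := countable_lebesgue_measure0 cR.
rewrite lebesgue_measure_itv/= lte_fin ltr01 oppr0 adde0 => /eqP.
by rewrite eqe oner_eq0.
Qed.

(* Each line of the first subspace is covered by countably many translates of
   the second, so two of its points lie in the same translate. *)
Lemma torus_affine_sub d d' (A : 'M[R]_(d, n)) (B : 'M[R]_(d', n)) x y :
  torus_pi @` [set x' | (x' - x <= A)%MS] `<=`
    torus_pi @` [set y' | (y' - y <= B)%MS] -> (A <= B)%MS.
Proof.
move=> sub; apply/row_subP => i; set v := row i A.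
have vA : (v <= A)%MS by exact: row_sub.
pose P (t : R) (z : 'rV[int]_n) := (x + t *: v + map_mx intr z - y <= B)%MS.
have [t|t [t' [z [tt' h h']]]] := @uncountable_pigeonhole P.
  have [|y' yB] := sub (torus_pi (x + t *: v)).
    by exists (x + t *: v) => //=; rewrite addrC addKr scalemx_sub.
  move=> /esym /torus_pi_eqP[z hz yE].
  exists (map_mx Num.floor z); rewrite /P.
  suff -> : map_mx intr (map_mx Num.floor z) = z by rewrite -yE.
  by apply/matrixP => a b; rewrite !mxE !ord1 floorK.
have : ((t - t') *: v <= B)%MS.
  rewrite (_ : _ *: v = (x + t *: v + map_mx intr z - y) -
      (x + t' *: v + map_mx intr z - y)); last first.
    by rewrite scalerBl; apply/matrixP => a b; rewrite !mxE; lra.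
  by rewrite addmx_sub// eqmx_opp.
by rewrite eqmx_scale// subr_eq0.
Qed.

(** Makes the choice in [torus_dim] unambiguous. *)
Lemma affine_image_dim (X : set torus) d d' :
  affine_image X d -> affine_image X d' -> d = d'.
Proof.
have H k (p : 'rV[R]_n) (A : 'M[R]_(k, n)) :
    [set p + u *m A | u in [set: 'rV[R]_k]] = [set y | (y - p <= A)%MS].
  apply/seteqP; split=> [_ [u _ <-]|y /= /submxP[u yE]] /=.
    by rewrite addrC addKr submxMl.
  by exists u => //; rewrite -yE addrC subrK.
move=> [p [A [fA XA]]] [p' [A' [fA' XA']]].
move: fA fA'; rewrite /row_free => /eqP <- /eqP <-; rewrite !H in XA XA'.
apply/eqP; rewrite eqn_leq; apply/andP; split; apply: mxrankS.
  by apply: (@torus_affine_sub _ _ _ _ p p'); rewrite -XA -XA'.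
by apply: (@torus_affine_sub _ _ _ _ p' p); rewrite -XA -XA'.
Qed.

Lemma torus_dim_affine (K : 'M[R]_n) x :
  torus_dim (torus_pi @` [set y | (y - x <= K)%MS]) = \rank K.
Proof.
have hK : affine_image (torus_pi @` [set y | (y - x <= K)%MS]) (\rank K).
  exists x, (row_base K); split; first exact: row_base_free.
  congr (_ @` _); apply/seteqP; split=> [y /=|_ [u _ <-]] /=.
    rewrite -(eq_row_base K) => /submxP[u yE].
    by exists u => //; rewrite -yE addrC subrK.
  by rewrite addrC addKr -(eq_row_base K) submxMl.
apply: (affine_image_dim _ hK); exact: (@getPex _ _ (ex_intro _ _ hK)).
Qed.

(** The normal is rescaled to a primitive integral vector [al]. An integral vector on which [al]
    takes the value 1 joins neighbouring parallel levels, so one level has the same image on the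
    torus as all levels at integral distance from it. *)
Lemma toric_hyperplane_int (h : set torus) : toric_hyperplane h ->
  exists (a : 'cV[R]_n) (b : R), (forall j, a j 0 \is a Num.int) /\
    h = torus_pi @` [set x | ev a x - b \is a Num.int].
Proof.
move=> [a [b [a0 ->]]].
pose D : int := \prod_i denq (a 0 i).
have D0 : (0 < D)%R by apply: prodr_gt0 => i _; exact: denq_gt0.
pose c i : int := numq (a 0 i) * \prod_(j | j != i) denq (a 0 j).
have cE i : (c i)%:~R = D%:~R * a 0 i :> rat.
  rewrite /D (bigD1 i)//= /c !intrM mulrAC; congr (_ * _).
  by rewrite numqE mulrC.
(* By Bezout, the least [k] satisfying [P] is the gcd of the coefficients [c i]. *)
pose P (k : nat) := (0 < k)%N /\ exists z : 'rV[int]_n, \sum_i c i * z 0 i = k%:Z.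
have [i ai] : exists i, a 0 i != 0.
  apply: contrapT => na; move/eqP: a0; apply; apply/rowP => i; rewrite mxE.
  by apply/eqP/negPn/negP => ai; apply: na; exists i.
have ci : c i != 0.
  by rewrite -(intr_eq0 rat) cE mulf_neq0// intr_eq0 gt_eqF.
have exP : exists k, `[< P k >].
  exists `|c i|%N; apply/asboolP; split; first by rewrite absz_gt0.
  exists (\row_j if j == i then sgz (c i) else 0).
  rewrite (bigD1 i)//= big1 ?addr0 => [|j ji]; last by rewrite mxE (negbTE ji) mulr0.
  by rewrite mxE eqxx mulrC -abszEsg abszE; lia.
case: (ex_minnP exP) => k0 /asboolP[k0p [z0 z0E]] kmin.
have kdvd j : (k0%:Z %| c j)%Z.
  apply/dvdz_mod0P; apply: contrapT => rN.
  pose r := (c j %% k0%:Z)%Z.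
  have r0 : 0 <= r by apply: modz_ge0; lia.
  have rk : r < k0%:Z by apply: ltz_pmod; lia.
  have : (k0 <= `|r|)%N.
    apply: kmin; apply/asboolP; split; first by rewrite absz_gt0; apply/eqP.
    exists (\row_i (i == j)%:R - (c j %/ k0%:Z)%Z *: z0).
    under eq_bigr do rewrite !mxE mulrBr mulrCA.
    rewrite sumrB -mulr_sumr z0E (bigD1 j)//= big1 => [|l /negbTE ->]; last by rewrite mulr0.
    rewrite eqxx mulr1 addr0 gez0_abs// /r {1}(divz_eq (c j) k0%:Z); lia.
  lia.
pose al : 'cV[R]_n := \col_j ((c j %/ k0%:Z)%Z)%:~R.
have k0N : k0%:R != 0 :> R by rewrite pnatr_eq0 -lt0n.
have DN : D%:~R != 0 :> R by rewrite intr_eq0 gt_eqF.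
have alE x : ev al x = D%:~R / k0%:R * \sum_i ratr (a 0 i) * x 0 i.
  rewrite /ev mxE mulr_sumr; apply: eq_bigr => j _; rewrite mxE mulrC mulrA.
  congr (_ * _); apply: (mulIf k0N); rewrite mulrAC divfK//.
  have -> : k0%:R = (k0%:Z)%:~R :> R by [].
  rewrite -intrM divzK ?kdvd// -[LHS]ratr_int cE rmorphM/=.
  by rewrite ratr_int.
pose z0R : 'rV[R]_n := map_mx intr z0.
have alz : ev al z0R = 1.
  apply: (mulIf k0N); rewrite mul1r /ev mxE.
  rewrite -[RHS](_ : (k0%:Z)%:~R = _ :> R)// -z0E raddf_sum/= mulr_suml.
  apply: eq_bigr => j _; rewrite !mxE -mulrA (_ : k0%:R = (k0%:Z)%:~R :> R)//.
  by rewrite -!intrM divzK ?kdvd// mulrC.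
exists al, (D%:~R / k0%:R * b); split=> [j|]; first by rewrite mxE intr_int.
apply/seteqP; split=> [_ [x /= xb <-]|_ [x /= xb <-]].
  by exists x => //=; rewrite alE xb subrr.
pose k := ev al x - D%:~R / k0%:R * b.
exists (x - k *: z0R) => /=.
  have DK : D%:~R / k0%:R != 0 :> R by rewrite mulf_neq0// invr_eq0.
  apply: (mulfI DK); rewrite -alE evB evZ alz mulr1 /k; lra.
rewrite -scaleNr; apply: torus_pi_add_int => j.
by rewrite !mxE mulNr rpredN rpredM// intr_int.
Qed.

End TorusTopology.

Lemma poly_nonroot (R : numDomainType) (q : {poly R}) : q != 0 -> exists t, q.[t] != 0.
Proof.
move=> q0; apply: contrapT => h.
pose rs : seq R := [seq j%:R | j <- iota 0 (size q)].
have : (size rs < size q)%N.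
  apply: max_poly_roots => //.
    apply/allP => t _; apply/negPn/negP => qt; apply: h; exists t.
    by rewrite -rootE.
  by rewrite map_inj_uniq ?iota_uniq// => j j' /eqP; rewrite eqr_nat => /eqP.
by rewrite size_map size_iota ltnn.
Qed.

Lemma open_disk_convex (R : realType) d (u v : 'rV[R]_d) (t : R) :
  @open_disk R d u -> @open_disk R d v -> 0 <= t <= 1 -> @open_disk R d (u + t *: (v - u)).
Proof.
rewrite /open_disk /= => hu hv /andP[t0 t1].
have : \sum_i (u + t *: (v - u)) 0 i ^+ 2 <=
    (1 - t) * (\sum_i u 0 i ^+ 2) + t * (\sum_i v 0 i ^+ 2).
  rewrite !mulr_sumr -big_split/=; apply: ler_sum => i _; rewrite !mxE.
  set x := u 0 i; set y := v 0 i.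
  have -> : (x + t * (y - x)) ^+ 2 = (1 - t) * x ^+ 2 + t * y ^+ 2 - t * (1 - t) * (y - x) ^+ 2.
    by rewrite !expr2; ring.
  by rewrite gerBl mulr_ge0 ?sqr_ge0// mulr_ge0// subr_ge0.
move=> /le_lt_trans; apply.
have [->|tN] := eqVneq t 0; first by rewrite subr0 mul1r mul0r addr0.
have tp : 0 < t by rewrite lt_neqAle eq_sym tN.
by nra.
Qed.

Lemma open_closed_disk (R : realType) d : @open_disk R d `<=` @closed_disk R d.
Proof. by move=> u /= /ltW. Qed.

(** * The subdivision of the line by the integers *)

Section UnitCells.
Variable R : realType.
Implicit Types s t p r : R.

(* [s] and [t] lie in the same cell of the subdivision of the line by the
   integers. *)
Definition same_cell1 s t : Prop :=
  Num.floor s = Num.floor t /\ Num.ceil s = Num.ceil t.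

Lemma same_cell1_refl s : same_cell1 s s. Proof. by []. Qed.
Lemma same_cell1_sym s t : same_cell1 s t -> same_cell1 t s.
Proof. by case. Qed.
Lemma same_cell1_trans s t r : same_cell1 s t -> same_cell1 t r -> same_cell1 s r.
Proof. by rewrite /same_cell1 => -[-> ->]. Qed.

Lemma same_cell1_int s t : same_cell1 s t ->
  (s \is a Num.int) = (t \is a Num.int).
Proof. by move=> [fE]; rewrite !ceil_floor fE => /addrI; do 2!case: (_ \is a _). Qed.

Lemma same_cell1_eq s t : same_cell1 s t -> s \is a Num.int -> s = t.
Proof.
move=> st si; have ti : t \is a Num.int by rewrite -(same_cell1_int st).
by case: st => + _; rewrite -{2}(floorK si) -{2}(floorK ti) => ->.
Qed.

Lemma same_cell1_addz s t k : k \is a Num.int ->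
  same_cell1 s t -> same_cell1 (s + k) (t + k).
Proof. by move=> ki [f c]; split; rewrite ?floorDrz ?ceilDrz ?f ?c. Qed.

Lemma same_cell1_bounds s t : same_cell1 s t <->
  [/\ (Num.floor s)%:~R <= t, t < (Num.floor s)%:~R + 1,
      (Num.ceil s)%:~R - 1 < t & t <= (Num.ceil s)%:~R].
Proof.
split=> [[f c]|[h1 h2 h3 h4]].
  have := floor_itv t; rewrite -f intrD => /andP[-> ->].
  by have := ceil_itv t; rewrite -c intrB => /andP[-> ->].
split; apply/esym/eqP; first by rewrite floor_eq intrD h1 h2.
by rewrite ceil_eq intrB h3 h4.
Qed.

Lemma same_cell1_convex s t t' r : same_cell1 s t -> same_cell1 s t' ->
  0 <= r <= 1 -> same_cell1 s (t + r * (t' - t)).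
Proof.
move=> /same_cell1_bounds[h1 h2 h3 h4] /same_cell1_bounds[k1 k2 k3 k4] /andP[r0 r1].
have [->|rN0] := eqVneq r 0; first by rewrite mul0r addr0; apply/same_cell1_bounds.
have rp : 0 < r by rewrite lt_neqAle eq_sym rN0.
by apply/same_cell1_bounds; split; nra.
Qed.

(** The closure of the cell of [s]; it shrinks to the point [s] when [s] is an integer. *)
Definition closed_cell1 s p : Prop := (Num.floor s)%:~R <= p <= (Num.ceil s)%:~R.

Lemma same_cell1_closed s t : same_cell1 s t -> closed_cell1 s t.
Proof. by move=> /same_cell1_bounds[h1 _ _ h4]; apply/andP. Qed.

Lemma closed_cell1_int s p : closed_cell1 s p -> s \is a Num.int -> p = s.
Proof.
move=> /andP[h1 h2] si; apply/eqP; rewrite eq_le.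
by rewrite (floorK si) in h1; rewrite (ceilK si) in h2; rewrite h1 h2.
Qed.

Lemma nint_floor_ceil s : s \isn't a Num.int ->
  (Num.ceil s)%:~R = (Num.floor s)%:~R + 1 :> R /\
  (Num.floor s)%:~R < s < (Num.ceil s)%:~R.
Proof.
move=> si; have -> : (Num.ceil s)%:~R = (Num.floor s)%:~R + 1 :> R.
  by rewrite ceil_floor si intrD.
split=> //; have := floor_itv s; rewrite intrD => /andP[h ->]; rewrite andbT.
rewrite lt_neqAle h andbT; apply: contra si => /eqP <-; exact: intr_int.
Qed.

Lemma closed_cell1_nint s p : closed_cell1 s p -> p \isn't a Num.int ->
  same_cell1 s p.
Proof.
move=> sp pi; have si : s \isn't a Num.int.
  by apply: contra pi => si; rewrite (closed_cell1_int sp si).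
have [cE /andP[h1 h2]] := nint_floor_ceil si; case/andP: sp => h3 h4.
have h5 : p != (Num.floor s)%:~R by apply: contra pi => /eqP ->; exact: intr_int.
have h6 : p != (Num.ceil s)%:~R by apply: contra pi => /eqP ->; exact: intr_int.
have h7 : (Num.floor s)%:~R < p by rewrite lt_neqAle eq_sym h5.
have h8 : p < (Num.ceil s)%:~R by rewrite lt_neqAle h6.
by apply/same_cell1_bounds; split; lra.
Qed.

Lemma closed_cell1_toward s p r : closed_cell1 s p -> 0 < r <= 1 ->
  same_cell1 s (p + r * (s - p)).
Proof.
move=> sp /andP[r0 r1]; have [si|si] := boolP (s \is a Num.int).
  by rewrite (closed_cell1_int sp si) subrr mulr0 addr0.
have [cE /andP[h1 h2]] := nint_floor_ceil si; case/andP: sp => h3 h4.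
by apply/same_cell1_bounds; split; nra.
Qed.

Lemma same_cell1_sgb s t k : same_cell1 s t -> k \is a Num.int ->
  sgb (s - k) = sgb (t - k).
Proof.
move=> st ki; have [si|si] := boolP (s \is a Num.int).
  by rewrite (same_cell1_eq st si).
have ti : t \isn't a Num.int by rewrite -(same_cell1_int st).
have nz r : r \isn't a Num.int -> r - k != 0.
  by apply: contra; rewrite subr_eq0 => /eqP ->.
rewrite /sgb (negbTE (nz _ si)) (negbTE (nz _ ti)) !subr_gt0; congr Some.
have E r : (k < r) = (Num.floor k < Num.ceil r) by rewrite ceil_gt_int floorK.
by rewrite !E; case: st => _ ->.
Qed.

(** Only three cells come within distance less than 1 of the integer [k]: the point [k] and the two
    unit intervals next to it. The sign tells them apart. *)
Lemma sgb_same_cell1 k s t : k \is a Num.int -> sgb (s - k) = sgb (t - k) ->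
  `|s - k| < 1 -> `|t - k| < 1 -> same_cell1 s t.
Proof.
move=> ki; wlog -> : k s t ki / k = 0.
  move=> h E s1 t1; have := h 0 (s - k) (t - k) (rpred0 _) erefl.
  rewrite !subr0 => /(_ E s1 t1) /(same_cell1_addz ki).
  by rewrite !subrK.
rewrite !subr0 !ltr_norml => E /andP[s1 s2] /andP[t1 t2].
have := sgb_true s; have := sgb_false s; rewrite E sgb_true sgb_false => h1 h2.
have F r : 0 < r -> r < 1 -> Num.floor r = 0 /\ Num.ceil r = 1.
  by move=> r0 r1; split; [apply: floor_def|apply: ceil_def]; rewrite ?r0 ?r1 ?(ltW r0) ?(ltW r1).
have G r : r < 0 -> -1 < r -> Num.floor r = -1 /\ Num.ceil r = 0.
  move=> r0 r1; split; [apply: floor_def|apply: ceil_def].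
    by rewrite addNr r0 (ltW r1).
  by rewrite sub0r r1 (ltW r0).
have [t0|t0|t0] := ltrgt0P t; rewrite t0 in h1 h2.
- by have [] := F _ t0 t2; have [] := F _ (esym h2) s2; split; congruence.
- by have [] := G _ t0 t1; have [] := G _ (esym h1) s1; split; congruence.
- rewrite !ltxx in h1 h2.
  have -> : s = 0 by apply: le_anti; rewrite !leNgt -h1 -h2.
  by rewrite t0.
Qed.

Lemma int_norm_lt1 t : t \is a Num.int -> `|t| < 1 -> t = 0.
Proof.
move=> ti t1; apply/eqP; rewrite -normr_eq0; apply: contraTT t1 => t0.
by rewrite -leNgt norm_intr_ge1// -normr_eq0.
Qed.

Lemma ray_int s c : (forall t : R, s + t * c \is a Num.int) -> c = 0.
Proof.
move=> h; apply/eqP/negPn/negP => c0.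
(* This [t] changes the value by one half, and two integers cannot differ by that. *)
have := h (2 * c)^-1; rewrite invfM -mulrA mulVf// mulr1.
have := h 0; rewrite mul0r addr0 => si; rewrite rpredDl//.
by move=> /int_norm_lt1; rewrite ger0_norm ?invr_ge0 ?ler0n// => E; lra.
Qed.

End UnitCells.

(** * Flats and cells of a toric arrangement *)

Section Arrangement.
Variables (R : realType) (n m : nat).
Variables (a : 'I_m -> 'cV[R]_n) (b : 'I_m -> R).
Hypothesis a_int : forall i j, a i j 0 \is a Num.int.
Implicit Types (x y z u v p q : 'rV[R]_n) (i : 'I_m) (J : {set 'I_m}).
Local Notation torus := (torus R n).
Local Notation torus_pi := (@torus_pi R n).

Definition integral (z : 'rV[R]_n) : Prop := forall j, z 0 j \is a Num.int.

Definition ell i x : R := ev (a i) x - b i.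

Lemma ellD i x u : ell i (x + u) = ell i x + ev (a i) u.
Proof. by rewrite /ell evD addrAC. Qed.

Lemma ell_sub i x y : ell i x - ell i y = ev (a i) (x - y).
Proof. by rewrite /ell evB; lra. Qed.

Lemma ev_integral i z : integral z -> ev (a i) z \is a Num.int.
Proof. by move=> hz; rewrite /ev mxE rpred_sum// => j _; rewrite rpredM. Qed.

Definition hyp i : set torus := torus_pi @` [set x | ell i x \is a Num.int].

Lemma ell_int_pi i x y : torus_pi x = torus_pi y ->
  (ell i x \is a Num.int) = (ell i y \is a Num.int).
Proof.
by move=> /torus_pi_eqP[z hz ->]; rewrite ellD (rpredDr _ (ev_integral i hz)).
Qed.

Lemma hypP i x : hyp i (torus_pi x) <-> ell i x \is a Num.int.
Proof.
split=> [[y /= yi /ell_int_pi]|xi]; last by exists x.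
by move=> <-.
Qed.

Definition act x : {set 'I_m} := [set i | ell i x \is a Num.int].

Lemma in_act i x : (i \in act x) = (ell i x \is a Num.int).
Proof. by rewrite inE. Qed.

Lemma act_pi x y : torus_pi x = torus_pi y -> act x = act y.
Proof. by move=> h; apply/setP => i; rewrite !inE (ell_int_pi i h). Qed.

Definition Ker J : 'M[R]_n := (\bigcap_(i in J) kermx (a i))%MS.

Lemma KerP J u : reflect (forall i, i \in J -> ev (a i) u = 0) (u <= Ker J)%MS.
Proof.
apply: (iffP sub_bigcapmxP) => h i /h; first by rewrite ev_eq0 => /eqP.
by rewrite ev_eq0 => ->.
Qed.

Lemma Ker_sub J J' : J \subset J' -> (Ker J' <= Ker J)%MS.
Proof.
move=> JJ; apply/sub_bigcapmxP => i iJ; apply: (bigcapmx_inf i) => //.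
exact: (fintype.subsetP JJ).
Qed.

(** In use [J] is contained in [act x]. Translating the direction space to [x] then gives the flat
    through [x] without recording the integral levels of the forms. *)
Definition flat J x : set torus := torus_pi @` [set y | (y - x <= Ker J)%MS].

Lemma flatP J x y : flat J x (torus_pi y) <->
  exists2 z, integral z & (y + z - x <= Ker J)%MS.
Proof.
split=> [[y' yK /esym/torus_pi_eqP[z hz yE]]|[z hz yK]].
  by exists z => //; rewrite -yE.
by exists (y + z) => //; exact: torus_pi_add_int.
Qed.

Lemma flat_refl J x : flat J x (torus_pi x).
Proof. by exists x => //=; rewrite subrr sub0mx. Qed.

Lemma flat_pi J x y : torus_pi x = torus_pi y -> flat J x = flat J y.
Proof.
move=> /torus_pi_eqP[z hz ->]; apply/seteqP; split=> _ [w wK <-] /=.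
  exists (w + z); last exact: torus_pi_add_int.
  by rewrite /= opprD addrACA subrr addr0.
exists (w - z); last by apply: torus_pi_add_int => j; rewrite mxE rpredN.
by move: wK; rewrite /= opprD addrA addrAC.
Qed.

Lemma flat_shift J x y : (y - x <= Ker J)%MS -> flat J y = flat J x.
Proof.
move=> yx; congr (_ @` _); apply/seteqP; split=> w /= h.
  by rewrite -(subrKA y) addmx_sub.
by rewrite -(subrKA x) addmx_sub// -opprB eqmx_opp.
Qed.

Lemma flat_eq J x y : flat J x (torus_pi y) -> flat J y = flat J x.
Proof.
move=> /flatP[z hz yK]; rewrite -(flat_shift yK); apply: flat_pi.
by rewrite torus_pi_add_int.
Qed.

Lemma flat_sub J J' x : (Ker J <= Ker J')%MS -> flat J x `<=` flat J' x.
Proof. by move=> JJ; apply: image_subset => y /= h; exact: submx_trans JJ. Qed.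

Lemma flat_subE J J' x y : flat J x `<=` flat J' y -> (Ker J <= Ker J')%MS.
Proof. exact: torus_affine_sub. Qed.

Lemma flat_ell J x y : J \subset act x -> flat J x (torus_pi y) -> J \subset act y.
Proof.
move=> /fintype.subsetP JA /flatP[z hz /KerP h]; apply/fintype.subsetP => i iJ.
have := JA _ iJ; rewrite !inE => xi.
have -> : ell i y = ell i x + ev (a i) (y + z - x) - ev (a i) z.
  by rewrite /ell !evE; lra.
by rewrite h// addr0 rpredB// ev_integral.
Qed.

Lemma flat_connected J x : connected (flat J x).
Proof.
apply: connected_continuous_connected; last first.
  by apply: continuous_subspaceT; exact: torus_pi_continuous.
apply: convex_connected => c d t /= cK dK _.
rewrite addrAC addmx_sub// scalemx_sub// -[d - c](subrKA x) addmx_sub//.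
by rewrite -opprB eqmx_opp.
Qed.

Lemma torus_dim_flat J x : torus_dim (flat J x) = \rank (Ker J).
Proof. exact: torus_dim_affine. Qed.

Definition same_cell x y : Prop := forall i, same_cell1 (ell i x) (ell i y).
Definition cell x : set torus := torus_pi @` [set y | same_cell x y].

Lemma same_cell_sym x y : same_cell x y -> same_cell y x.
Proof. by move=> h i; apply: same_cell1_sym. Qed.
Lemma same_cell_trans y x z : same_cell x y -> same_cell y z -> same_cell x z.
Proof. by move=> h k i; apply: same_cell1_trans (h i) (k i). Qed.

Lemma same_cell_addz x y z : integral z -> same_cell x y ->
  same_cell (x + z) (y + z).
Proof.
by move=> hz h i; rewrite !ellD; apply: same_cell1_addz => //; exact: ev_integral.
Qed.

Lemma integralN z : integral z -> integral (- z).
Proof. by move=> hz j; rewrite mxE rpredN. Qed.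

Lemma cellP x y : cell x (torus_pi y) <-> exists2 z, integral z & same_cell x (y + z).
Proof.
split=> [[y' yK /esym/torus_pi_eqP[z hz yE]]|[z hz yK]].
  by exists z => //; rewrite -yE.
by exists (y + z) => //; exact: torus_pi_add_int.
Qed.

Lemma cell_refl x : cell x (torus_pi x).
Proof. by exists x. Qed.

Lemma cell_pi x y : torus_pi x = torus_pi y -> cell x = cell y.
Proof.
move=> /torus_pi_eqP[z hz ->]; apply/seteqP; split=> _ [w wK <-] /=.
  by exists (w + z); [exact: same_cell_addz|exact: torus_pi_add_int].
exists (w - z); last by apply: torus_pi_add_int; exact: integralN.
by have := same_cell_addz (integralN hz) wK; rewrite addrK.
Qed.

Lemma cell_same x y : same_cell x y -> cell x = cell y.
Proof.
move=> xy; congr (_ @` _); apply/seteqP; split=> w /=; apply: same_cell_trans => //.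
exact: same_cell_sym.
Qed.

Lemma cell_eq x y : cell x (torus_pi y) -> cell y = cell x.
Proof.
move=> /cellP[z hz h]; rewrite (cell_same h); apply: cell_pi.
by rewrite torus_pi_add_int.
Qed.

Lemma cell_eqP x y : cell x = cell y <-> exists2 z, integral z & same_cell x (y + z).
Proof.
split=> [E|/cellP/cell_eq //]; by apply/cellP; rewrite E; exact: cell_refl.
Qed.

Lemma same_cell_act x y : same_cell x y -> act x = act y.
Proof. by move=> h; apply/setP => i; rewrite !inE (same_cell1_int (h i)). Qed.

Lemma same_cell_Ker x y : same_cell x y -> (y - x <= Ker (act x))%MS.
Proof.
move=> h; apply/KerP => i; rewrite inE => xi.
by rewrite -ell_sub (same_cell1_eq (h i) xi) subrr.
Qed.

Lemma cell_act x y : cell x (torus_pi y) -> act y = act x.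
Proof.
move=> /cellP[z hz /same_cell_act ->]; apply: act_pi.
by rewrite torus_pi_add_int.
Qed.

Lemma cell_sub_flat J x y : J \subset act y -> flat J y (torus_pi x) ->
  cell x `<=` flat J y.
Proof.
move=> JA xF; rewrite -(flat_eq xF) => _ [w xw <-].
have JAx := flat_ell JA xF.
exists w => //=; apply: submx_trans (same_cell_Ker xw) _; exact: Ker_sub.
Qed.

Lemma same_cell_convex x c d (t : R) : same_cell x c -> same_cell x d ->
  0 <= t <= 1 -> same_cell x (c + t *: (d - c)).
Proof.
move=> xc xd t01 i; rewrite ellD evZ -ell_sub.
exact: same_cell1_convex.
Qed.

Lemma cell_connected x : connected (cell x).
Proof.
apply: connected_continuous_connected; last first.
  by apply: continuous_subspaceT; exact: torus_pi_continuous.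
by apply: convex_connected => c d t; exact: same_cell_convex.
Qed.

(** Localizes the arrangement: only the hyperplanes through [x] are visible nearby. For a form not
    integral at [x], the admissible variation is the distance of its value to the nearest
    integer. *)
Lemma near_cells x : \forall y \near x, forall i,
  (ell i x \is a Num.int -> `|ev (a i) (y - x)| < 1) /\
  (ell i x \isn't a Num.int -> same_cell1 (ell i x) (ell i y)).
Proof.
apply: (@filter_forall _ _ _ (nbhs x)) => i.
have cf : ev (a i) y @[y --> x] --> ev (a i) x by exact: ev_continuous.
have nb (e : R) : 0 < e -> \forall y \near x, `|ev (a i) x - ev (a i) y| < e.
  by move=> e0; move/cvgrPdist_lt : cf => /(_ e e0).
have [xi|xi] := boolP (ell i x \is a Num.int).
  apply: filterS (nb 1 ltr01) => y h; split=> // _.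
  by rewrite evB distrC.
have [cE /andP[h1 h2]] := nint_floor_ceil xi.
pose e := Num.min (ell i x - (Num.floor (ell i x))%:~R) ((Num.ceil (ell i x))%:~R - ell i x).
have e0 : 0 < e by rewrite lt_min !subr_gt0 h1.
apply: filterS (nb e e0) => y h; split=> // _.
move: h; rewrite lt_min !ltr_norml => /andP[/andP[k1 k2] /andP[k3 k4]].
by apply/same_cell1_bounds; rewrite /ell in cE h1 h2 k1 k2 k3 k4 *; split; lra.
Qed.

(** * The intersection poset and the cells described through lifts *)

Section IntersectionPoset.
Variable H : set (set torus).
Hypothesis HE : H = [set hyp i | i in [set: 'I_m]].

Definition idx (S : set (set torus)) : {set 'I_m} := [set i | `[< S (hyp i) >]].

Lemma in_idx S i : reflect (S (hyp i)) (i \in idx S).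
Proof. by rewrite inE; exact: asboolP. Qed.

Lemma bigcap_idx S x : S `<=` H ->
  (\bigcap_(h in S) h) (torus_pi x) <-> idx S \subset act x.
Proof.
move=> SH; split=> [h|/fintype.subsetP h s Ss].
  by apply/fintype.subsetP => i; move=> /in_idx Si; rewrite in_act; apply/hypP; exact: h.
have := SH _ Ss; rewrite HE => -[i _ iE]; subst s.
by apply/hypP; rewrite -in_act; apply: h; apply/in_idx.
Qed.

(** Different indices may give the same hyperplane of the torus; [idx S] is the saturation of [J]
    under this coincidence. *)
Lemma idx_image J : exists S, [/\ S `<=` H, J \subset idx S &
  forall x, J \subset act x -> idx S \subset act x].
Proof.
exists (hyp @` [set` J]); split.
- by move=> _ [i _ <-]; rewrite HE; exists i.
- by apply/fintype.subsetP => i iJ; apply/in_idx; exists i.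
- move=> x /fintype.subsetP h; apply/fintype.subsetP => i /in_idx[j jJ jE].
  by rewrite in_act; apply/hypP; rewrite -jE; apply/hypP; rewrite -in_act; exact: h.
Qed.

(** Nearby points of the intersection differ by a vector on which each form of [idx S] is integral
    and of absolute value less than 1, hence zero. Flats are therefore open in the intersection. *)
Lemma component_flat S x : S `<=` H -> idx S \subset act x ->
  connected_component (\bigcap_(h in S) h) (torus_pi x) = flat (idx S) x.
Proof.
move=> SH Sx; apply: connected_componentE.
- move=> _ [y yK <-]; apply/bigcap_idx => //; apply: (flat_ell Sx).
  by exists y.
- exact: flat_connected.
- exact: flat_refl.
move=> y /bigcap_idx-/(_ SH) Sy; apply: filterS (near_cells y) => w hw.
move=> /bigcap_idx-/(_ SH) Sw.
have wy : (w - y <= Ker (idx S))%MS.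
  apply/KerP => i iS; have /[!inE] yi := fintype.subsetP Sy _ iS.
  have /[!inE] wi := fintype.subsetP Sw _ iS.
  apply: int_norm_lt1; last exact: (hw i).1.
  by rewrite -ell_sub rpredB.
split=> /flat_eq h; rewrite -h; first by rewrite (flat_shift wy); exact: flat_refl.
by rewrite -(flat_shift wy); exact: flat_refl.
Qed.

(** Along a line from [x] in a direction of [Ker J] the forms of [J] are constant, so those of
    [idx S] stay integral on the whole line and are constant too. *)
Lemma Ker_eq_idx J S x : J \subset idx S ->
  (forall y, J \subset act y -> idx S \subset act y) -> J \subset act x ->
  (Ker J <= Ker (idx S))%MS.
Proof.
move=> JS hS /fintype.subsetP Jx; apply/rV_subP => u /KerP uJ.
apply/KerP => i iS; apply: (@ray_int _ (ell i x)) => t.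
have /hS/fintype.subsetP/(_ i iS) : J \subset act (x + t *: u).
  apply/fintype.subsetP => j jJ; have := Jx _ jJ.
  by rewrite !inE ellD evZ uJ// mulr0 addr0.
by rewrite inE ellD evZ.
Qed.

Lemma int_posetP X : int_poset H X <->
  X = set0 \/ exists J x, J \subset act x /\ X = flat J x.
Proof.
split=> [[->|[S [SH [q Sq <-]]]]|[->|[J [x [Jx ->]]]]]; [by left| |by left|]; right.
  have [x xq] := torus_pi_surj q; rewrite -xq in Sq *.
  move/bigcap_idx : Sq => /(_ SH) Sx.
  by exists (idx S), x; split=> //; exact: component_flat.
have [S [SH JS hS]] := idx_image J; exists S; split=> //.
exists (torus_pi x); first by apply/bigcap_idx => //; exact: hS.
rewrite component_flat//; last exact: hS.
apply/seteqP; split; apply: flat_sub; first exact: Ker_sub.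
exact: (@Ker_eq_idx _ _ x).
Qed.

Lemma stratum_idx S x : S `<=` H ->
  stratum H S (torus_pi x) <-> act x = idx S.
Proof.
move=> SH; rewrite /stratum; split=> [[/bigcap_idx-/(_ SH) Sx nx]|E].
  apply/eqP; rewrite finset.eqEsubset Sx andbT; apply/fintype.subsetP => i.
  rewrite in_act => xi; apply/in_idx; apply: contrapT => nS; apply: nx.
  by exists (hyp i); [split=> //; rewrite HE; exists i|apply/hypP].
split; first by apply/bigcap_idx; rewrite // E.
move=> [h [Hh nS] hx]; apply: nS.
move: Hh; rewrite HE => -[i _ iE]; subst h.
have : i \in act x by rewrite in_act; apply/hypP.
by rewrite E => /in_idx.
Qed.

Lemma component_cell S x : S `<=` H -> act x = idx S ->
  connected_component (stratum H S) (torus_pi x) = cell x.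
Proof.
move=> SH Sx; apply: connected_componentE.
- by move=> _ [y xy <-]; apply/stratum_idx; rewrite // -(same_cell_act xy).
- exact: cell_connected.
- exact: cell_refl.
move=> y /stratum_idx-/(_ SH) Sy; apply: filterS (near_cells y) => w hw.
move=> /stratum_idx-/(_ SH) Sw.
have yw : same_cell y w.
  move=> i; have [h1 h2] := hw i; have [yi|] := boolP (ell i y \is a Num.int); last exact: h2.
  have wi : ell i w \is a Num.int.
    have : i \in act w by rewrite Sw -Sy inE.
    by rewrite inE.
  have E : ev (a i) (w - y) = 0.
    by apply: int_norm_lt1; [rewrite -ell_sub rpredB|exact: h1].
  have -> : ell i w = ell i y by apply/eqP; rewrite -subr_eq0 ell_sub E.
  exact: same_cell1_refl.
split=> /cell_eq h; rewrite -h; last by rewrite (cell_same yw); exact: cell_refl.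
by rewrite -(cell_same yw); exact: cell_refl.
Qed.

Lemma act_idx x : exists2 S, S `<=` H & act x = idx S.
Proof.
exists [set h | H h /\ h (torus_pi x)]; first by move=> h [].
apply/setP => i; rewrite in_act; apply/idP/in_idx => [xi|[_ /hypP//]].
by split; [rewrite HE; exists i|apply/hypP].
Qed.

Lemma cellsP e : cells H e <-> exists x, e = cell x.
Proof.
split=> [[S [SH [q Sq <-]]]|[x ->]].
  have [x xq] := torus_pi_surj q; rewrite -xq in Sq *.
  by exists x; apply: component_cell => //; apply/stratum_idx.
have [S SH E] := act_idx x; exists S; split=> //.
by exists (torus_pi x); [apply/stratum_idx|exact: component_cell].
Qed.

Definition supp x := flat (act x) x.

Lemma supp_poset x : int_poset H (supp x).
Proof. by apply/int_posetP; right; exists (act x), x. Qed.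

Lemma poset_contains X x : int_poset H X -> X (torus_pi x) ->
  exists2 J : {set 'I_m}, J \subset act x & X = flat J x.
Proof.
move=> /int_posetP[->//|[J [y [Jy ->]]]] xF.
by exists J; [exact: (flat_ell Jy)|rewrite (flat_eq xF)].
Qed.

Lemma poset_cell X x : int_poset H X -> X (torus_pi x) -> cell x `<=` X.
Proof.
move=> PX Xx; have [J Jx ->] := poset_contains PX Xx.
by apply: cell_sub_flat => //; exact: flat_refl.
Qed.

Lemma supp_min X x : int_poset H X -> X (torus_pi x) -> supp x `<=` X.
Proof.
move=> PX Xx; have [J Jx ->] := poset_contains PX Xx.
by apply: flat_sub; exact: Ker_sub.
Qed.

Lemma zt_cell x : zt H (Cell (cell x)) = Some (supp x).
Proof.
have hs : is_smallest_containing H (cell x) (supp x).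
  split; first exact: supp_poset.
    by apply: poset_cell; [exact: supp_poset|exact: flat_refl].
  by move=> Y PY /(_ _ (cell_refl x)); exact: supp_min.
congr Some; have := xgetPex set0 (ex_intro _ _ hs).
set X := xget _ _ => -[PX sX minX]; case: hs => Ps ss mins.
by apply/seteqP; split; [exact: minX|exact: mins].
Qed.

Lemma hat_le_refl (X : option (set torus)) : hat_le X X.
Proof. by case: X => [X|] //; exact: subset_refl. Qed.

Lemma hat_le_anti (X Y : option (set torus)) : hat_le X Y -> hat_le Y X -> X = Y.
Proof. by case: X => [X|]; case: Y => [Y|] //= h k; congr Some; apply/seteqP. Qed.

Lemma hat_le_trans (X Y Z : option (set torus)) :
  hat_le X Y -> hat_le Y Z -> hat_le X Z.
Proof.
by case: X => [X|]; case: Y => [Y|] //; case: Z => [Z|] //= h k; exact: subset_trans k h.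
Qed.

(** A flat is the union of the cells it contains, so it is determined by a subset of the finite set
    of cells. *)
Lemma hat_poset_finite : finite_set (cells H) -> finite_set (hat_poset H).
Proof.
move=> /finite_seqP[s sE].
pose U (J : {set 'I_(size s)}) : set torus := \bigcup_(i in [set` J]) nth set0 s i.
suff sub : hat_poset H `<=` [set None] `|` (Some \o U) @` setT.
  apply: (sub_finite_set sub); rewrite finite_setU; split; first exact: finite_set1.
  by apply: finite_image; exact: finite_finset.
case=> [X /= PX|_]; last by left.
right; exists [set i : 'I_(size s) | `[< nth set0 s i `<=` X >]]%SET => //; congr Some.
apply/seteqP; split=> [q [i]|q Xq].
  by rewrite /= finset.inE => /asboolP; apply.
have [x xq] := torus_pi_surj q; rewrite -xq in Xq *.
have xs : cell x \in s.
  by have : cells H (cell x) by [apply/cellsP; exists x]; rewrite sE.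
have ils : (index (cell x) s < size s)%N by rewrite index_mem.
exists (Ordinal ils) => /=; last by rewrite nth_index//; exact: cell_refl.
by rewrite finset.inE; apply/asboolP; rewrite /= nth_index//; exact: poset_cell.
Qed.

(** * The central arrangement at a point *)

Section Local.
Variable p : 'rV[R]_n.

(* A hyperplane that misses [p] becomes the zero form, which constrains no sign
   vector. *)
Definition loc i : 'cV[R]_n := if i \in act p then a i else 0.

Definition sgv u : {ffun 'I_m -> option bool} := [ffun i => sgb (ev (loc i) u)].

(** In a realized sign vector the indices outside [act p] also carry [None], because their local
    form is zero; they are left out here. *)
Definition zeros (s : {ffun 'I_m -> option bool}) : {set 'I_m} :=
  [set i in act p | s i == None].

Lemma ev_loc i u : i \in act p -> ev (loc i) u = ev (a i) u.
Proof. by rewrite /loc => ->. Qed.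

Lemma ev_locN i u : i \notin act p -> ev (loc i) u = 0.
Proof. by rewrite /loc => /negbTE ->; rewrite /ev mulmx0 mxE. Qed.

Lemma sgvP u v : sgv u = sgv v <->
  forall i, i \in act p -> sgb (ev (a i) u) = sgb (ev (a i) v).
Proof.
split=> [/ffunP h i ip|h]; first by have := h i; rewrite !ffunE !ev_loc.
apply/ffunP => i; rewrite !ffunE; have [ip|ip] := boolP (i \in act p).
  by rewrite !ev_loc// h.
by rewrite !ev_locN.
Qed.

Lemma sgv_scale (t : R) u : 0 < t -> sgv (t *: u) = sgv u.
Proof. by move=> t0; apply/sgvP => i _; rewrite evZ sgb_mulr. Qed.

Lemma in_zeros u i : (i \in zeros (sgv u)) = (i \in act p) && (ev (a i) u == 0).
Proof.
rewrite inE; have [ip|//] := boolP (i \in act p).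
by rewrite /= ffunE sgb_None ev_loc.
Qed.

Lemma Ker_zeros u : (u <= Ker (zeros (sgv u)))%MS.
Proof. by apply/KerP => i; rewrite in_zeros => /andP[_ /eqP]. Qed.

Lemma zeros_act s : zeros s \subset act p.
Proof. by apply/fintype.subsetP => i; rewrite inE => /andP[]. Qed.

Lemma sub_zeros J u : J \subset act p -> (u <= Ker J)%MS -> J \subset zeros (sgv u).
Proof.
move=> /fintype.subsetP Jp /KerP h; apply/fintype.subsetP => i iJ.
by rewrite in_zeros Jp// h/=.
Qed.

Definition sflat s := flat (zeros s) p.

Lemma sflat_sub J u : J \subset act p ->
  sflat (sgv u) `<=` flat J p <-> (u <= Ker J)%MS.
Proof.
move=> Jp; split=> [/flat_subE h|h]; first exact: submx_trans (Ker_zeros u) h.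
by apply: flat_sub; apply: Ker_sub; exact: sub_zeros.
Qed.

(** A sign vector realized in [Ker J] vanishes on [J], so the subspace in which [euler_cells]
    measures its dimension is [Ker (zeros s)]. *)
Lemma euler_local J (C : set 'rV[R]_n) : J \subset act p ->
  rel_open_convex (Ker J) C -> C !=set0 ->
  \sum_(s | `[< exists2 u, C u & sgv u = s >]) (-1) ^+ \rank (Ker (zeros s))
  = (-1) ^+ \rank (Ker J) :> int.
Proof.
move=> Jp hC C0; rewrite -(euler_cells loc hC C0).
apply: eq_big => s.
  apply/asboolP/asboolP => -[u Cu hu]; exists u => //.
    by move=> i; rewrite -hu ffunE.
  by apply/ffunP => i; rewrite ffunE hu.
move=> /asboolP[u Cu hu]; congr (_ ^+ _).
apply/eqP; rewrite eqn_leq; apply/andP; split; apply: mxrankS.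
  rewrite sub_capmx; apply/andP; split.
    apply: Ker_sub; rewrite -hu; apply: sub_zeros => //.
    by case: hC => h _ _; exact: h.
  apply/sub_bigcapmxP => i si; have [ip|ip] := boolP (i \in act p).
    by rewrite /loc ip; apply: (bigcapmx_inf i) => //; rewrite inE ip.
  apply/rV_subP => v _; rewrite ev_eq0 /loc (negbTE ip).
  by rewrite /ev mulmx0 mxE.
apply: submx_trans (capmxSr _ _) _; apply/sub_bigcapmxP => i; rewrite inE => /andP[ip si].
by apply: (bigcapmx_inf i) => //; rewrite /loc ip.
Qed.

Definition realizable s : bool := `[< exists u, sgv u = s >].

Hypothesis finH : finite_set (hat_poset H).
Local Notation mu := (mobius (hat_poset H) (@hat_le R n)).
Local Notation hat_interval := (po_interval (hat_poset H) (@hat_le R n)).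

Lemma sflat_poset s : hat_poset H (Some (sflat s)).
Proof. by apply/int_posetP; right; exists (zeros s), p; split=> //; exact: zeros_act. Qed.

Lemma sflat_supp s : supp p `<=` sflat s.
Proof. by apply: flat_sub; apply: Ker_sub; exact: zeros_act. Qed.

Lemma interval_flat X Z : hat_interval (Some X) (Some (supp p)) Z ->
  exists J, [/\ J \subset act p, Z = Some (flat J p) & flat J p `<=` X].
Proof.
case: Z => [Z|] [PZ XZ ZY] //.
have [J Jp ZE] := poset_contains PZ (ZY _ (flat_refl _ _)).
by exists J; rewrite -ZE.
Qed.

Lemma flat_neq0 J x : flat J x != set0.
Proof. by apply/set0P; exists (torus_pi x); exact: flat_refl. Qed.

Lemma rank_flat J x : hat_rank (Some (flat J x)) = (n - \rank (Ker J)).+1.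
Proof. by rewrite /= (negbTE (flat_neq0 _ _)) torus_dim_flat. Qed.

Lemma sign_rank J J' x y : (Ker J' <= Ker J)%MS ->
  (-1) ^+ (hat_rank (Some (flat J' y)) - hat_rank (Some (flat J x))) =
  (-1) ^+ \rank (Ker J) * (-1) ^+ \rank (Ker J') :> int.
Proof.
move=> /mxrankS JJ; rewrite !rank_flat.
have h := rank_leq_row (Ker J).
have -> : ((n - \rank (Ker J')).+1 - (n - \rank (Ker J)).+1 = \rank (Ker J) - \rank (Ker J'))%N by lia.
rewrite -{2}(subnK JJ) exprD -mulrA -exprMn mulrNN mulr1 expr1n mulr1; lia.
Qed.

Definition flat_sign (Z : option (set torus)) : int :=
  if Z is Some Z then (-1) ^+ torus_dim Z else 0.

(** The sign vectors spanning [flat J p] all have the same dimension sign, so multiplying by that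
    sign turns the weighted sum left by Moebius inversion into a count. *)
Lemma local_inversion (Q : pred {ffun 'I_m -> option bool})
    (g : option (set torus) -> int) J : J \subset act p ->
  (forall s, Q s -> realizable s) ->
  (forall J', J' \subset act p -> (Ker J' <= Ker J)%MS ->
    \sum_(s | Q s && `[< exists2 u, (u <= Ker J')%MS & sgv u = s >])
      (-1) ^+ \rank (Ker (zeros s)) = g (Some (flat J' p))) ->
  (-1) ^+ \rank (Ker J) *
    (\sum_(Z \in hat_interval (Some (flat J p)) (Some (supp p)))
       mu (Some (flat J p)) Z * g Z) =
  \sum_(s | Q s && (sflat s == flat J p)) 1.
Proof.
move=> Jp Qr gE.
rewrite (@mobius_inversion _ _ _ finH _ _ _ _ Q (Some \o sflat)
  (fun s => (-1) ^+ \rank (Ker (zeros s)))).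
- rewrite mulr_sumr; apply: eq_big => [s|s /andP[_ /eqP[]]] //=.
  move=> E; suff -> : \rank (Ker (zeros s)) = \rank (Ker J).
    by rewrite -exprMn mulrNN mulr1 expr1n.
  by rewrite -!(torus_dim_flat _ p) -E.
- by move=> X _; exact: hat_le_refl.
- by move=> X Y _ _; exact: hat_le_anti.
- by move=> X Y Z _ _ _; exact: hat_le_trans.
- by apply/int_posetP; right; exists J, p.
- exact: supp_poset.
- by move=> s _; split; [exact: sflat_poset|exact: sflat_supp].
move=> Z /interval_flat[J' [J'p -> J'J]]; rewrite -gE//; last exact: flat_subE J'J.
apply: eq_bigl => s; have [Qs|//] := boolP (Q s); rewrite /=.
have /asboolP[u us] := Qr _ Qs; rewrite -us.
apply/asboolP/asboolP => [/= h|[v vJ vs]] /=.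
  by exists u => //; apply/sflat_sub.
by rewrite -vs; apply/sflat_sub.
Qed.

Lemma local_count J : J \subset act p ->
  Zsum (hat_poset H) (@hat_le R n) (@hat_rank R n) (Some (flat J p)) (Some (supp p)) =
  \sum_(s | realizable s && (sflat s == flat J p)) 1.
Proof.
move=> Jp; rewrite -(@local_inversion _ flat_sign)//.
  rewrite /Zsum mulr_fsumr; apply: eq_fsbigr => Z; rewrite inE.
  move=> /interval_flat[J' [J'p -> J'J]].
  rewrite sign_rank; last exact: flat_subE J'J.
  by rewrite /flat_sign torus_dim_flat -mulrA; congr (_ * _); rewrite mulrC.
move=> J' J'p _; rewrite /flat_sign torus_dim_flat.
rewrite -(euler_local J'p (rel_open_convex_full _)); last by exists 0; rewrite /= sub0mx.
apply: eq_bigl => s; apply/andP/asboolP => [[_ /asboolP//]|[u uJ us]].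
by split; apply/asboolP; exists u.
Qed.

Variable nu : 'cV[R]_n.
Hypothesis nu_gen : forall J, Ker J != 0 -> Ker J *m nu != 0.
Hypothesis vertex : Ker (act p) = 0.

Definition nonneg s : bool := `[< forall u, sgv u = s -> 0 <= ev nu u >].

(** The function to be inverted is the indicator of [supp p], so inversion keeps only the value of
    the Moebius function at the top of the interval. *)
Lemma vertex_count J : J \subset act p ->
  (-1) ^+ (hat_rank (Some (supp p)) - hat_rank (Some (flat J p))) *
    mu (Some (flat J p)) (Some (supp p)) =
  \sum_(s | [&& realizable s, nonneg s & sflat s == flat J p]) 1 :> int.
Proof.
move=> Jp; under eq_bigl do rewrite andbA.
rewrite -(@local_inversion _ (fun Z => (Z == Some (supp p))%:R))//; last 2 first.
- by move=> s /andP[].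
- move=> J' J'p _.
  pose T (C : set 'rV[R]_n) : int :=
    \sum_(s | `[< exists2 u, C u & sgv u = s >]) (-1) ^+ \rank (Ker (zeros s)).
  pose C1 : set 'rV[R]_n := [set u | (u <= Ker J')%MS].
  (* The sign vectors that are not nonnegative are those realized in [C2]. *)
  pose C2 : set 'rV[R]_n := C1 `&` [set u | ev nu u < 0].
  have -> : \sum_(s | realizable s && nonneg s && `[< exists2 u, (u <= Ker J')%MS & sgv u = s >])
      (-1) ^+ \rank (Ker (zeros s)) = T C1 - T C2.
    rewrite /T; apply/eqP; rewrite eq_sym subr_eq; apply/eqP.
    rewrite (bigID nonneg) /=; congr (_ + _); apply: eq_bigl => s.
      rewrite andbAC; case: asboolP => [[u _ us]|_].
        by rewrite andTb /realizable asboolT ?andTb ?andbT//; exists u.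
      by rewrite andbF.
    apply/andP/asboolP => [[/asboolP[u uJ us] /asboolPn h]|[u [uJ nu0] us]].
      have [v /not_implyP[vs /negP]] := (existsNP _).2 h; rewrite -ltNge => vn.
      exists v => //; split=> //=; apply/sflat_sub => //; rewrite vs -us.
      exact/sflat_sub.
    split; first by apply/asboolP; exists u.
    by apply/asboolPn => /(_ u us); rewrite leNgt nu0.
  have hC1 : T C1 = (-1) ^+ \rank (Ker J').
    apply: euler_local => //; first exact: rel_open_convex_full.
    by exists 0; rewrite /C1 /= sub0mx.
  (* On the zero subspace the negative half is empty and the difference is 1. On any other it is
     nonempty, since [nu] is generic, and the two Euler sums cancel. *)
  have [K0|KN0] := eqVneq (Ker J') 0.
    have -> : T C2 = 0.
      rewrite /T big_pred0// => s; apply/asboolP => -[u [uJ nu0] _].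
      by move: uJ nu0; rewrite /C1 /= K0 submx0 => /eqP ->; rewrite ev0 ltxx.
    rewrite hC1 K0 mxrank0 subr0 (_ : _ == _)//; apply/eqP; congr Some.
    by apply/seteqP; split; apply: flat_sub; rewrite ?K0 ?vertex.
  have -> : T C2 = (-1) ^+ \rank (Ker J').
    apply: euler_local => //; first exact: rel_open_convex_neg (rel_open_convex_full _).
    have [v vJ vn] := ev_neq0P (nu_gen KN0).
    have [vneg|vpos] := ltP (ev nu v) 0; first by exists v.
    exists (- v); split; first by rewrite /C1 /= eqmx_opp.
    by rewrite /= evN oppr_lt0 lt_neqAle eq_sym vn.
  rewrite hC1 subrr; case: eqP => // -[E].
  have : \rank (Ker J') = \rank (Ker (act p)) by rewrite -!(torus_dim_flat _ p) E.
  by move/eqP; rewrite vertex mxrank0 mxrank_eq0 (negbTE KN0).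
rewrite (fsbigD1 (Some (supp p)))/=; last 2 first.
- by apply: sub_finite_set finH => Z [] *.
- split; [exact: supp_poset| |exact: hat_le_refl].
  by apply: flat_sub; exact: Ker_sub.
rewrite eqxx mulr1 fsbig1 ?addr0 => [|Z [_ /eqP/negbTE ->]]; last by rewrite mulr0.
rewrite /supp sign_rank; last exact: Ker_sub.
by rewrite vertex mxrank0 mulr1.
Qed.

End Local.

(** * Adjacency of cells and regularity *)

Definition near_cell p y : Prop := forall i,
  (ell i p \is a Num.int -> `|ev (a i) (y - p)| < 1) /\
  (ell i p \isn't a Num.int -> same_cell1 (ell i p) (ell i y)).

(** Near [p], a form not integral at [p] stays in the cell of its value there, and a form integral
    at [p] is located by its sign alone. *)
Lemma near_same p y y' : near_cell p y -> near_cell p y' ->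
  sgv p (y - p) = sgv p (y' - p) -> same_cell y y'.
Proof.
move=> hy hy' /sgvP h i; have [py1 py2] := hy i; have [py1' py2'] := hy' i.
have [pi|pi] := boolP (ell i p \is a Num.int); last first.
  exact: same_cell1_trans (same_cell1_sym (py2 pi)) (py2' pi).
apply: (@sgb_same_cell1 _ (ell i p)) => //; rewrite !ell_sub; last 2 first.
- exact: py1.
- exact: py1'.
by apply: h; rewrite in_act.
Qed.

Lemma same_sgv p y y' : same_cell y y' -> sgv p (y - p) = sgv p (y' - p).
Proof.
move=> h; apply/sgvP => i; rewrite in_act => pi; rewrite -!ell_sub.
exact: same_cell1_sgb.
Qed.

(* [p] lies in the closed cell of [y], upstairs in [R^n]. *)
Definition adj p y : Prop := forall i, closed_cell1 (ell i y) (ell i p).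

Lemma near_adj p y : near_cell p y -> adj p y.
Proof.
move=> hy i; have [h1 h2] := hy i; have [pi|pi] := boolP (ell i p \is a Num.int); last first.
  exact: same_cell1_closed (same_cell1_sym (h2 pi)).
have := h1 pi; rewrite -ell_sub ltr_norml => /andP[k1 k2].
rewrite /closed_cell1 -(floorK pi) !ler_int.
rewrite -(floorK pi) in k1 k2; set k := Num.floor (ell i p) in k1 k2 *.
have h3 : Num.floor (ell i y) < k + 1 by rewrite floor_lt_int intrD; lra.
have h4 : k - 1 < Num.ceil (ell i y) by rewrite ceil_gt_int intrB; lra.
by apply/andP; split; lia.
Qed.

Lemma adj_toward p y (r : R) : adj p y -> 0 < r <= 1 ->
  same_cell y (p + r *: (y - p)).
Proof. by move=> h r01 i; rewrite ellD evZ -ell_sub; exact: closed_cell1_toward. Qed.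

Lemma adj_same p y y' : same_cell y y' -> adj p y -> adj p y'.
Proof. by move=> h k i; have := k i; rewrite /closed_cell1; have [-> ->] := h i. Qed.

Lemma adj_same_l p p' y : same_cell p p' -> adj p y -> adj p' y.
Proof.
move=> h k i; have [pi|pi] := boolP (ell i p \is a Num.int).
  by rewrite -(same_cell1_eq (h i) pi); exact: k.
apply: same_cell1_closed; apply: same_cell1_trans (h i).
exact: closed_cell1_nint.
Qed.

Lemma same_cell_addzr x y z : integral z -> same_cell x (y + z) -> same_cell (x - z) y.
Proof. by move=> hz /(same_cell_addz (integralN hz)); rewrite addrK. Qed.

Lemma adj_nbhs_ray p y (U : set 'rV[R]_n) : adj p y -> nbhs p U ->
  exists2 r : R, 0 < r <= 1 & U (p + r *: (y - p)) /\ same_cell y (p + r *: (y - p)).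
Proof.
move=> py /nbhs_ray-/(_ (y - p))[e e0 he].
exists (Num.min (e / 2) 1).
  by rewrite lt_min ltr01 divr_gt0//= ge_min lexx orbT.
split; first apply: he.
  by rewrite le_min ler01 divr_ge0 ?(ltW e0)//= gt_min; apply/orP; left; lra.
by apply: adj_toward => //; rewrite lt_min ltr01 divr_gt0//= ge_min lexx orbT.
Qed.

(** A point of the cell near [p] yields an integral translate of [y] whose closed cell contains [p].
    Conversely, the segment from [p] towards [y + z] runs inside the cell of [y + z] and enters
    every neighbourhood of [p]. *)
Lemma closure_cellP p y : closure (cell y) (torus_pi p) <->
  exists2 z, integral z & adj p (y + z).
Proof.
split=> [/closure_torusP/(_ _ (near_cells p))[w pw /cellP[z hz yw]]|[z hz h]].
  exists (- z); first exact: integralN.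
  apply: adj_same (near_adj pw); apply: same_cell_sym; exact: same_cell_addzr.
apply/closure_torusP => U /(adj_nbhs_ray h)[r _ [Ur yr]].
exists (p + r *: (y + z - p)) => //.
rewrite (@cell_pi y (y + z)); last by rewrite torus_pi_add_int.
by rewrite (cell_same yr); exact: cell_refl.
Qed.

Lemma cell_closureP p y : cell p `<=` closure (cell y) <->
  closure (cell y) (torus_pi p).
Proof.
split=> [h|/closure_cellP[z hz h] _ [q pq <-]]; first exact/h/cell_refl.
by apply/closure_cellP; exists z => //; exact: adj_same_l h.
Qed.

Lemma adj_act p y : adj p y -> act y = zeros p (sgv p (y - p)).
Proof.
move=> h; apply/setP => i; rewrite in_zeros !in_act -ell_sub subr_eq0.
apply/idP/andP => [yi|[pi /eqP ->//]].
by have := closed_cell1_int (h i) yi => ->; rewrite yi eqxx.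
Qed.

Lemma adj_supp p y : adj p y -> supp y = sflat p (sgv p (y - p)).
Proof.
move=> h; rewrite /supp /sflat (adj_act h); apply: flat_shift.
exact: Ker_zeros.
Qed.

(** A representative of [s] short enough for [p + dir p s] to stay near [p]. The default is reached
    only when [s] is not realizable. *)
Definition dir p s : 'rV[R]_n :=
  xget 0 [set u | sgv p u = s /\ near_cell p (p + u)].

Lemma dirP p s : realizable p s -> sgv p (dir p s) = s /\ near_cell p (p + dir p s).
Proof.
move=> /asboolP[u us].
apply: (@xgetPex _ 0 [set u | sgv p u = s /\ near_cell p (p + u)]).
have [e e0 he] := nbhs_ray u (near_cells p).
exists ((e / 2) *: u); split; first by rewrite sgv_scale// divr_gt0.
by apply: he; rewrite divr_ge0 ?(ltW e0)//=; lra.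
Qed.

Lemma dir_adj p s : realizable p s -> adj p (p + dir p s).
Proof. by move=> /dirP[_ /near_adj]. Qed.

Lemma dir_sgv p s : realizable p s -> sgv p (p + dir p s - p) = s.
Proof. by move=> /dirP[h _]; rewrite addrAC subrr add0r. Qed.

Lemma sgv_real p u : realizable p (sgv p u).
Proof. by apply/asboolP; exists u. Qed.

(** Sliding [y] towards [p] changes neither its cell nor its sign vector, and near [p] the sign
    vector determines the cell. *)
Lemma dirE p y : adj p y -> same_cell y (p + dir p (sgv p (y - p))).
Proof.
move=> py; have [r /andP[r0 _] [Ur yr]] := adj_nbhs_ray py (near_cells p).
have [h1 h2] := dirP (sgv_real p (y - p)).
apply: same_cell_trans yr _; apply: near_same Ur h2 _.
have E v : p + v - p = v by rewrite addrAC subrr add0r.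
by rewrite !E h1 sgv_scale.
Qed.

(** Otherwise a small convex piece of the open disk would have a connected image that avoids the
    hyperplane, being inside the cell, and yet meets both of its sides. *)
Lemma regular_no_straddle d p y y' i : regular_cell R d (cell y) ->
  i \in act p -> adj p y -> adj p y' -> cell y = cell y' ->
  0 < ev (a i) (y - p) -> ev (a i) (y' - p) < 0 -> False.
Proof.
set e := cell y => -[f [g [fc gc gK fD fO]]] ip py py' ee c0 c0'.
have pe : closure e (torus_pi p).
  by apply/closure_cellP; exists 0; [move=> j; rewrite mxE|rewrite addr0].
(* Radius one half makes the projection injective on [V], so the two sides of the hyperplane have
   disjoint images. *)
pose U := [set w | near_cell p w /\ forall j, `|w 0 j - p 0 j| < 2^-1].
have nU : nbhs p U.
  apply: filterI; first exact: near_cells.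
  apply: (@filter_forall _ _ _ (nbhs p)) => j.
  have cj : (M : 'rV[R]_n) 0 j @[M --> p] --> p 0 j by exact: coord_continuous.
  have h2 : (0 : R) < 2^-1 by rewrite invr_gt0.
  by move/cvgrPdist_lt : cj => /(_ _ h2); apply: filterS => w; rewrite distrC.
pose V := interior U.
have oV : open V by exact: open_interior.
pose O1 := torus_pi @` (V `&` [set w | ev (a i) p < ev (a i) w]).
pose O2 := torus_pi @` (V `&` [set w | ev (a i) w < ev (a i) p]).
have oO1 : open O1 by apply: torus_pi_open; apply: openI => //; exact: open_ev_gt.
have oO2 : open O2 by apply: torus_pi_open; apply: openI => //; exact: open_ev_lt.
have piV w w' : V w -> V w' -> torus_pi w = torus_pi w' -> w = w'.
  move=> /interior_subset[_ hw] /interior_subset[_ hw'] /torus_piE E.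
  apply/rowP => j; apply/eqP; rewrite -subr_eq0; apply/eqP.
  apply: int_norm_lt1 (E j) _.
  have -> : w 0 j - w' 0 j = (w 0 j - p 0 j) - (w' 0 j - p 0 j) by lra.
  apply: le_lt_trans (ler_normB _ _) _; have := hw j; have := hw' j; lra.
have disj (q : torus) : O1 q -> O2 q -> False.
  move=> [w [Vw /= h1] <-] [w' [Vw' /= h2] /(piV _ _ Vw' Vw) E].
  by move: h2; rewrite E ltNge (ltW h1).
have iy : i \notin act y.
  by rewrite (adj_act py) in_zeros ip/= gt_eqF.
have cover (q : torus) : e q -> (torus_pi @` V) q -> O1 q \/ O2 q.
  move=> eq [w Vw wq]; rewrite -wq in eq *.
  have iw : i \notin act w by rewrite (cell_act eq).
  have : ev (a i) w != ev (a i) p.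
    apply: contra iw => /eqP E; rewrite in_act.
    by have : ell i w = ell i p by [rewrite /ell E]; move=> ->; rewrite -in_act.
  rewrite neq_lt => /orP[h|h]; [right|left]; by exists w.
pose s := g (torus_pi p).
have : (f @` @closed_disk R d) (torus_pi p) by rewrite fD.
move=> [s' Ds' fs']; have gs : g (torus_pi p) = s'.
  by rewrite -fs' gK// inE.
have Ds : @closed_disk R d s by rewrite /s gs.
have fs : f s = torus_pi p by rewrite /s gs.
have VO : nbhs (f s) (torus_pi @` V).
  by rewrite fs; apply: torus_pi_nbhs; apply: open_nbhs_nbhs.
have /subspace_continuousP /(_ _ Ds) fcs := fc.
have /nbhs_ballP[dl /= dl0 hdl] := fcs _ VO.
(* The ball keeps the image of [G] in the projection of [V], and the open disk keeps it in the
   cell. *)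
pose G := ball s dl `&` @open_disk R d.
have GD : G `<=` @closed_disk R d by move=> u [_ /open_closed_disk].
have cfG : connected (f @` G).
  apply: connected_continuous_connected; last exact: continuous_subspaceW fc.
  apply: convex_connected => c1 c2 t [b1 o1] [b2 o2] t01.
  split; last exact: open_disk_convex.
  move: b1 b2; rewrite -!ball_normE /ball_ /= => b1 b2; case/andP: t01 => t0 t1.
  have -> : s - (c1 + t *: (c2 - c1)) = (1 - t) *: (s - c1) + t *: (s - c2).
    by apply/matrixP => k l; rewrite !mxE; ring.
  apply: le_lt_trans (ler_normD _ _) _; rewrite !normrZ !ger0_norm ?subr_ge0//.
  have [->|tN] := eqVneq t 0; first by rewrite subr0 mul1r mul0r addr0.
  have tp : 0 < t by rewrite lt_neqAle eq_sym tN.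
  by nra.
have fGe : f @` G `<=` e by rewrite -fO => _ [u [_ uo] <-]; exists u.
have fGV : f @` G `<=` torus_pi @` V.
  by move=> _ [u Gu <-]; apply: hdl; [case: Gu|exact: GD].
(* Continuity of [g] at the projection of [p] puts the disk coordinates of points of the cell close
   to [p] into [G]. *)
have meets y1 : adj p y1 -> cell y1 = e -> exists2 r : R, 0 < r &
    V (p + r *: (y1 - p)) /\ (f @` G) (torus_pi (p + r *: (y1 - p))).
  move=> py1 ey1.
  have /subspace_continuousP /(_ _ pe) gcs := gc.
  have : nbhs (g (torus_pi p)) (ball s dl) by exact: nbhsx_ballx.
  move=> /gcs /torus_pi_continuous nW.
  have nV : nbhs p V by apply: open_nbhs_nbhs.
  have nVW : nbhs p (V `&` [set w | closure e (torus_pi w) -> ball s dl (g (torus_pi w))]).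
    exact: filterI.
  have [r /andP[r0 _] [[Vr Wr] yr]] := adj_nbhs_ray py1 nVW.
  exists r => //; split=> //.
  have er : e (torus_pi (p + r *: (y1 - p))) by rewrite -ey1 (cell_same yr); exact: cell_refl.
  have : (f @` @open_disk R d) (torus_pi (p + r *: (y1 - p))) by rewrite fO.
  move=> [u uo fu]; exists u => //; split=> //.
  have -> : u = g (torus_pi (p + r *: (y1 - p))).
    by rewrite -fu gK// inE; exact: open_closed_disk.
  by apply: Wr; exact: subset_closure.
have [r r0 [Vr Gr]] := meets _ py erefl.
have [r' r0' [Vr' Gr']] := meets _ py' (esym ee).
have m1 : O1 (torus_pi (p + r *: (y - p))).
  by exists (p + r *: (y - p)) => //; split=> //=; rewrite evD evZ ltrDl mulr_gt0.
have m2 : O2 (torus_pi (p + r' *: (y' - p))).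
  by exists (p + r' *: (y' - p)) => //; split=> //=; rewrite evD evZ gtrDl pmulr_rlt0.
have : (f @` G) `&` O1 = f @` G.
  apply: cfG.
  - by exists (torus_pi (p + r *: (y - p))).
  - by exists O1.
  - exists (~` O2); first exact: open_closedC.
    apply/seteqP; split=> q [Gq h]; split=> //; first by move=> /(disj _ h).
    by case: (cover _ (fGe _ Gq) (fGV _ Gq)).
by move=> E; move: Gr'; rewrite -E => -[_ /disj/(_ m2)].
Qed.

(** Equal cells have the same active forms, so the zero entries agree; the others agree because the
    cell cannot straddle a hyperplane through [p]. *)
Lemma regular_sgv d p y y' : regular_cell R d (cell y) ->
  adj p y -> adj p y' -> cell y = cell y' -> sgv p (y - p) = sgv p (y' - p).
Proof.
move=> reg py py' ee; apply/sgvP => i ip.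
have aE : act y = act y' by apply: cell_act; rewrite -ee; exact: cell_refl.
have /setP/(_ i) : zeros p (sgv p (y - p)) = zeros p (sgv p (y' - p)).
  by rewrite -!adj_act.
rewrite !in_zeros ip /= /sgb => cE; rewrite cE; case: eqP => // /eqP y'0; congr Some.
have y0 : ev (a i) (y - p) != 0 by rewrite cE.
apply/idP/idP => [pos|pos]; rewrite ltNge; apply/negP => neg.
  by apply: (regular_no_straddle reg ip py py' ee pos); rewrite lt_neqAle y'0.
rewrite ee in reg.
by apply: (regular_no_straddle reg ip py' py (esym ee) pos); rewrite lt_neqAle y0.
Qed.

(** No further hyperplane meets [supp p], so this flat is a single cell containing its own closure.
    A closed disk of positive dimension has boundary points, so the cell is one point, and a
    subspace projecting to one point is zero. *)
Lemma regular_vertex d p : regular_cell R d (cell p) ->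
  (forall q, supp p (torus_pi q) -> act q = act p) -> Ker (act p) = 0.
Proof.
move=> [f [g [_ _ gK fD fO]]] actE.
have evK i u : i \notin act p -> (u <= Ker (act p))%MS -> ev (a i) u = 0.
  move=> ip uK; apply/eqP/negPn/negP => c0.
  pose t := - ell i p / ev (a i) u.
  have /actE E : supp p (torus_pi (p + t *: u)).
    by exists (p + t *: u) => //=; rewrite addrAC subrr add0r scalemx_sub.
  move: ip; rewrite -E in_act ellD evZ divfK// addrN rpred0.
  by [].
have scell : supp p `<=` cell p.
  move=> _ [y yK <-]; exists y => // i; rewrite -[y](subrK p) addrC ellD.
  have [ip|ip] := boolP (i \in act p); last by rewrite evK// addr0.
  by move/KerP: yK => /(_ i ip) ->; rewrite addr0.
have clE : closure (cell p) `<=` cell p.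
  move=> q; have [w <-] := torus_pi_surj q => /closure_cellP[z hz wp].
  apply: scell; apply/flatP; exists (- z); first exact: integralN.
  apply/KerP => i; rewrite in_act => pi.
  have pzi : ell i (p + z) \is a Num.int by rewrite ellD rpredD// ev_integral.
  rewrite -addrA -opprD [z + p]addrC -ell_sub (closed_cell1_int (wp i) pzi).
  by rewrite subrr.
have [d0|d'] : d = 0%N \/ exists d', d = d'.+1 by case: (d) => [|d']; [left|right; exists d'].
  have sing (q q' : torus) : cell p q -> cell p q' -> q = q'.
    rewrite -fO; subst d => -[u _ <-] [u' _ <-]; congr f; apply/rowP; by case.
  apply/eqP; rewrite -submx0; apply/rV_subP => u uK; rewrite submx0; apply/eqP.
  apply/rowP => j; rewrite mxE; apply: (@ray_int _ 0) => t.
  have : torus_pi (p + t *: u) = torus_pi p.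
    apply: sing; last exact: cell_refl.
    apply: scell; exists (p + t *: u) => //=.
    by rewrite addrAC subrr add0r scalemx_sub.
  by move=> /torus_piE/(_ j); rewrite !mxE add0r addrAC subrr add0r.
case: d' => d' dE; subst d.
(* The image of this boundary point lies in the closure, hence in the cell, so it also comes from
   the open disk, against injectivity of [f]. *)
pose u : 'rV[R]_d'.+1 := delta_mx 0 0.
have uS : \sum_i u 0 i ^+ 2 = 1.
  rewrite (bigD1 0)//= big1 => [|i i0]; first by rewrite mxE !eqxx expr1n addr0.
  by rewrite mxE (negbTE i0) andbF expr0n.
have uc : closed_disk u by rewrite /closed_disk /= uS.
have : cell p (f u) by apply: clE; rewrite -fD; exists u.
rewrite -fO => -[v vo fvu]; have : v = u.
  by rewrite -(gK u) ?inE// -(gK v) ?inE ?fvu//; exact: open_closed_disk.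
by move=> vu; move: vo; rewrite vu /open_disk /= uS ltxx.
Qed.

(** * Lowest vertices of cells *)

(** [nu] is a point of the moment curve: its value on a vector is that of a polynomial at [t]. One
    nonzero row is taken from each nonzero [Ker J], and [t] avoids the roots of the product of their
    polynomials. *)
Lemma generic_functional : exists nu : 'cV[R]_n,
  forall J, Ker J != 0 -> Ker J *m nu != 0.
Proof.
pose q J := rVpoly (nz_row (Ker J)).
have [t qt] : exists t, (\prod_(J | Ker J != 0) q J).[t] != 0.
  apply: poly_nonroot; rewrite prodf_seq_neq0; apply/allP => J _; apply/implyP => JN.
  apply: contra JN => /eqP E; rewrite -nz_row_eq0.
  by rewrite -(rVpolyK (nz_row (Ker J))) -/(q J) E linear0.
exists (\col_j t ^+ j) => J JN.
have : (q J).[t] != 0.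
  move: qt; rewrite horner_prod prodf_seq_neq0 => /allP/(_ J).
  by rewrite mem_index_enum => /(_ isT)/implyP; apply.
apply: contra => /eqP E.
have : nz_row (Ker J) *m \col_j t ^+ j = 0.
  by have /submxP[D ->] := nz_row_sub (Ker J); rewrite -mulmxA E mulmx0.
move=> /matrixP/(_ 0 0); rewrite !mxE => E'.
rewrite /q /rVpoly horner_poly -[X in _ == X]E'; apply/eqP/eq_bigr => j _.
by rewrite (valK j) mxE.
Qed.

Section Minimizers.
Variable nu : 'cV[R]_n.
Hypothesis nu_gen : forall J, Ker J != 0 -> Ker J *m nu != 0.

Definition minimizer q y : Prop :=
  adj q y /\ forall q', adj q' y -> ev nu q <= ev nu q'.

Lemma adj_self y : adj y y.
Proof. by move=> i; exact: same_cell1_closed. Qed.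

(** The forms have no common kernel, so their values determine the point through [pinvmx M]. Those
    values are bounded on a closed cell, and hence so are the coordinates. *)
Lemma closed_cells_compact y : Ker [set: 'I_m] = 0 -> compact [set q | adj q y].
Proof.
move=> K0; pose M : 'M[R]_(n, m) := \matrix_(j, i) a i j 0.
have ME u i : (u *m M) 0 i = ev (a i) u.
  by rewrite /ev !mxE; apply: eq_bigr => j _; rewrite mxE.
have Mfree : row_free M.
  rewrite -kermx_eq0 -submx0; apply/rV_subP => u /sub_kermxP uM.
  rewrite -K0; apply/KerP => i _; by rewrite -ME uM mxE.
pose c i : R := `|(Num.floor (ell i y))%:~R| + `|(Num.ceil (ell i y))%:~R| + `|b i|.
pose B j : R := \sum_i c i * `|pinvmx M i j|.
apply: (@subclosed_compact _ _ [set v : 'rV[R]_n | forall j, `[- B j, B j]%classic (v ord0 j)]).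
- have -> : [set q | adj q y] = \bigcap_(i in [set: 'I_m])
     (~` [set q | ev (a i) q < (Num.floor (ell i y))%:~R + b i] `&`
      ~` [set q | (Num.ceil (ell i y))%:~R + b i < ev (a i) q]).
    apply/seteqP; split=> [q h i _|q h i] /=.
      by have /andP[h1 h2] := h i; split; apply/negP; rewrite -leNgt /ell in h1 h2 *; lra.
    have [/negP h1 /negP h2] := h i I; rewrite -leNgt in h1; rewrite -leNgt in h2.
    by apply/andP; rewrite /ell; split; lra.
  apply: closed_bigI => i _; apply: closedI; apply: open_closedC.
    exact: open_ev_lt.
  exact: open_ev_gt.
- by apply: (@rV_compact _ _ (fun j => `[- B j, B j]%classic)) => j; exact: segment_compact.
move=> q h j /=; rewrite in_itv /= -ler_norml.
have -> : q = q *m M *m pinvmx M by rewrite -mulmxA mulmxVp// mulmx1.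
rewrite mxE; apply: le_trans (ler_norm_sum _ _ _) _; apply: ler_sum => i _.
rewrite normrM ler_wpM2r// ME /c.
have /andP[h1 h2] := h i.
have -> : ev (a i) q = ell i q + b i by rewrite /ell subrK.
apply: le_trans (ler_normD _ _) _; rewrite lerD2r.
have k1 := ler_norm ((Num.ceil (ell i y))%:~R : R).
have k2 := ler_norm (- ((Num.floor (ell i y))%:~R : R)); rewrite normrN in k2.
have k3 := normr_ge0 ((Num.floor (ell i y))%:~R : R).
have k4 := normr_ge0 ((Num.ceil (ell i y))%:~R : R).
by rewrite ler_norml; apply/andP; split; lra.
Qed.

Lemma minimizer_exists y : Ker [set: 'I_m] = 0 -> exists q, minimizer q y.
Proof.
move=> K0; have c : {within [set q | adj q y], continuous (ev nu)}.
  by apply: continuous_subspaceT; exact: ev_continuous.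
have [|q] := compact_EVT_min _ (closed_cells_compact (y := y) K0) c.
  by exists y; exact: adj_self.
rewrite inE => qy qmin; exists q; split=> // q' q'y; apply: qmin.
by rewrite inE.
Qed.

(** Otherwise some direction in [Ker (act q)] lowers [nu], and a short step along it stays in the
    cell of [q], hence in the closed cell of [y]. *)
Lemma minimizer_vertex q y : minimizer q y -> Ker (act q) = 0.
Proof.
move=> [qy qmin]; apply/eqP/negPn/negP => KN.
have [v vK vn] := ev_neq0P (nu_gen KN).
have [w wK wn] : exists2 w, (w <= Ker (act q))%MS & ev nu w < 0.
  have [vneg|vpos] := ltP (ev nu v) 0; first by exists v.
  by exists (- v); rewrite ?eqmx_opp// evN oppr_lt0 lt_neqAle eq_sym vn.
have [e e0 he] := nbhs_ray w (near_cells q).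
have t0 : 0 < e / 2 by rewrite divr_gt0.
have /he hn : 0 <= e / 2 < e by lra.
have sc : same_cell q (q + (e / 2) *: w).
  move=> i; have [_ h2] := hn i; have [qi|] := boolP (ell i q \is a Num.int); last exact: h2.
  by rewrite ellD evZ (KerP _ _ wK) ?in_act// mulr0 addr0.
have := qmin _ (adj_same_l sc qy); rewrite evD evZ lerDl pmulr_rge0//.
by rewrite leNgt wn.
Qed.

(* The midpoint of two minimizers is a minimizer, and the forms active at it
   vanish on their difference. *)
Lemma minimizer_unique q q' y : minimizer q y -> minimizer q' y -> q = q'.
Proof.
move=> [qy qmin] [qy' qmin']; pose r := q + 2^-1 *: (q' - q).
have nuE : ev nu q = ev nu q'.
  by apply: le_anti; rewrite qmin// qmin'.
have ry : adj r y.
  move=> i; rewrite /r ellD evZ -ell_sub; have /andP[h1 h2] := qy i; have /andP[h3 h4] := qy' i.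
  by apply/andP; split; lra.
have rmin : minimizer r y.
  by split=> // p py; rewrite /r !evE -nuE subrr mulr0 addr0; exact: qmin.
have : (q' - q <= Ker (act r))%MS.
  apply/KerP => i; rewrite in_act => ri; rewrite -ell_sub.
  have rE : ell i r = ell i q + 2^-1 * (ell i q' - ell i q) by rewrite /r ellD evZ -ell_sub.
  have /andP[h1 h2] := qy i; have /andP[h3 h4] := qy' i.
  have [yi|yi] := boolP (ell i y \is a Num.int).
    by rewrite (closed_cell1_int (qy i) yi) (closed_cell1_int (qy' i) yi) subrr.
  have [cE _] := nint_floor_ceil yi.
  have /andP[h5 h6] := ry i.
  (* An integer between two consecutive integers is one of them. An extreme value taken at the
     midpoint is then taken at both ends. *)
  have : ell i r = (Num.floor (ell i y))%:~R \/ ell i r = (Num.ceil (ell i y))%:~R.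
    have k1 : Num.floor (ell i y) <= Num.floor (ell i r) by rewrite floor_ge_int.
    have k2 : Num.floor (ell i r) <= Num.ceil (ell i y) by rewrite -(ler_int R) floorK.
    have k3 : Num.ceil (ell i y) = Num.floor (ell i y) + 1.
      by apply/eqP; rewrite -(eqr_int R) cE intrD.
    have : Num.floor (ell i r) = Num.floor (ell i y) \/ Num.floor (ell i r) = Num.ceil (ell i y) by lia.
    by case=> E; [left|right]; rewrite -E floorK.
  by case=> E; lra.
rewrite (minimizer_vertex rmin) submx0 subr_eq0 => /eqP; exact: esym.
Qed.

(** For [q] in the closed cell, the points on the way from [q] to [y] lie in the cell of [y] and
    share its sign vector at [p]. The inequality for them passes to the limit at [q]. *)
Lemma nonneg_minimizer p y : adj p y -> nonneg p nu (sgv p (y - p)) -> minimizer p y.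
Proof.
move=> py /asboolP nn; split=> // q qy.
have h (r : R) : 0 < r <= 1 -> 0 <= ev nu (q - p) + r * ev nu (y - q).
  move=> r01; have := same_sgv p (adj_toward qy r01) => /esym/nn.
  by rewrite addrAC evD evZ.
rewrite -subr_ge0 -evB leNgt; apply/negP => neg.
have [e e0 he] := @small_perturb _ _ (- ev nu (y - q)) (ltac:(by rewrite oppr_gt0) : 0 < - ev nu (q - p)).
pose r := Num.min (e / 2) 1.
have r0 : 0 < r by rewrite lt_min ltr01 divr_gt0.
have re : r < e by rewrite gt_min; apply/orP; left; lra.
have r1 : r <= 1 by rewrite ge_min lexx orbT.
have := he r; rewrite (ltW r0) re => /(_ isT); have := h r; rewrite r0 r1 => /(_ isT).
lra.
Qed.

(** A short step from [p] in any direction with this sign vector lands in the cell of [y]. *)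
Lemma minimizer_nonneg p y : minimizer p y -> nonneg p nu (sgv p (y - p)).
Proof.
move=> [py pmin]; apply/asboolP => u us.
have [e e0 he] := nbhs_ray u (near_cells p).
have t0 : 0 < e / 2 by rewrite divr_gt0.
have /he hn : 0 <= e / 2 < e by lra.
have sc : same_cell y (p + (e / 2) *: u).
  have [r /andP[r0 _] [Ur yr]] := adj_nbhs_ray py (near_cells p).
  have E v : p + v - p = v by rewrite addrAC subrr add0r.
  apply: same_cell_trans yr _; apply: near_same Ur hn _.
  by rewrite !E !sgv_scale.
have := pmin (p + (e / 2) *: u); rewrite evD evZ lerDl pmulr_rge0//; apply.
by move=> i; apply: same_cell1_closed; exact: sc.
Qed.

Lemma adj_addz p y z : integral z -> adj p y -> adj (p + z) (y + z).
Proof.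
move=> hz h i; have ei := ev_integral i hz; rewrite !ellD /closed_cell1.
rewrite (floorDrz _ ei) (ceilDrz _ ei) !intrD (floorK ei) (ceilK ei) !lerD2r.
exact: h.
Qed.

Lemma minimizer_addz p y z : integral z -> minimizer p y -> minimizer (p + z) (y + z).
Proof.
move=> hz [py pmin]; split=> [|q qy]; first exact: adj_addz.
have := pmin (q - z); rewrite evB evD -lerBrDr; apply.
by have := adj_addz (integralN hz) qy; rewrite addrK.
Qed.

Lemma sgv_pi p p' : torus_pi p = torus_pi p' -> sgv p = sgv p'.
Proof.
move=> /act_pi E; apply/funext => u; apply/ffunP => i.
by rewrite !ffunE /loc E.
Qed.

Lemma supp_pi p p' : torus_pi p = torus_pi p' -> supp p = supp p'.
Proof. by move=> h; rewrite /supp (act_pi h) (flat_pi _ h). Qed.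

Lemma supp_vertex p q : Ker (act p) = 0 -> supp p (torus_pi q) -> torus_pi q = torus_pi p.
Proof.
move=> K0 /flatP[z hz]; rewrite K0 submx0 subr_eq0 => /eqP <-.
by rewrite torus_pi_add_int.
Qed.

Lemma supp_cell x y : cell x = cell y -> supp x = supp y.
Proof. by move=> E; have := zt_cell x; rewrite E zt_cell => -[]. Qed.

End Minimizers.

(** * Counting cells on the torus under regularity *)

Section Regular.
Hypothesis finC : finite_set (cells H).
Hypothesis reg : forall x, exists d, regular_cell R d (cell x).

Local Notation Pos := (hat_poset H).
Local Notation Le := (@hat_le R n).
Local Notation Rk := (@hat_rank R n).

(** At a point with the largest number of active forms the active set is constant along the support,
    so [regular_vertex] applies. *)
Lemma essential : Ker [set: 'I_m] = 0.
Proof.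
have exP : exists k, `[< exists p, #|act p| = k >].
  by exists #|act 0|; apply/asboolP; exists 0.
have bP k : `[< exists p, #|act p| = k >] -> (k <= m)%N.
  by move=> /asboolP[p <-]; rewrite -[X in (_ <= X)%N]card_ord max_card.
case: (ex_maxnP exP bP) => k /asboolP[p pk] kmax.
have [d rd] := reg p.
have K0 : Ker (act p) = 0.
  apply: (regular_vertex rd) => q qp; apply/esym/eqP; rewrite eqEcard.
  rewrite (flat_ell _ qp)// pk; apply: kmax; apply/asboolP; by exists q.
apply/eqP; rewrite -submx0 -K0; apply: Ker_sub; exact: finset.subsetT.
Qed.

Lemma supp_neq0 p : supp p <> set0.
Proof. by apply/eqP; exact: flat_neq0. Qed.

(** A minimal nonempty flat is the support of each of its points, so the active set is constant on
    it and regularity makes it a vertex. *)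
Lemma coatomP X w : int_poset H X ->
  po_coatoms Pos Le (Some X) (Some set0) w <->
  exists p, [/\ w = Some (supp p), Ker (act p) = 0 & X (torus_pi p)].
Proof.
move=> PX; split.
  case: w => [W|] [[PW XW _] [_ WN] wmax] //.
  have /set0P[q Wq] : W != set0 by apply/eqP => W0; apply: WN; rewrite W0.
  have minW p : W (torus_pi p) -> supp p = W.
    move=> Wp; apply: contrapT => ne; apply: (wmax (Some (supp p))).
    - exact: supp_poset.
    - by split; [exact: supp_min|move=> [E]; apply: ne].
    - by split; [exact: sub0set|move=> [E]; apply: (@supp_neq0 p)].
  have [p pq] := torus_pi_surj q; rewrite -pq in Wq.
  exists p; split; [by rewrite minW| |exact: XW].
  have [d rd] := reg p; apply: (regular_vertex rd) => r pr.
  apply/eqP; rewrite finset.eqEsubset (flat_ell _ pr)// andbT.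
  have rp : supp r (torus_pi p).
    by rewrite minW//; rewrite minW// in pr.
  exact: (flat_ell _ rp).
move=> [p [-> K0 Xp]]; split.
- split; [exact: supp_poset|exact: supp_min|exact: sub0set].
- by split; [exact: sub0set|move=> [E]; apply: (@supp_neq0 p)].
case=> [V|] PV [Vp Vn] [_ VN]; last by [].
have /set0P[q Vq] : V != set0 by apply/eqP => V0; apply: VN; rewrite V0.
apply: Vn; congr Some; apply/seteqP; split=> // q' pq'.
have [r rq] := torus_pi_surj q; have [r' rq'] := torus_pi_surj q'.
rewrite -rq in Vq; rewrite -rq' in pq' *.
by rewrite (supp_vertex K0 pq') -(supp_vertex K0 (Vp _ Vq)).
Qed.

Let finP : finite_set Pos := hat_poset_finite finC.

(** Cells around [p] correspond to sign vectors at [p]; regularity gives injectivity. The outer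
    index set has one element because the base point is fixed. *)
Lemma step_count X p : int_poset H X -> X (torus_pi p) ->
  exists N : nat,
    ([set e | [/\ cells H e, zt H (Cell e) = Some X & cell p `<=` closure e]]
       #= `I_N)%card /\
    N%:Z = Zsum Pos Le Rk (Some X) (Some (supp p)).
Proof.
move=> PX Xp; have [J Jp XE] := poset_contains PX Xp.
have [|||N [AN NE]] := @card_indexed_bij _ _ {ffun 'I_m -> option bool} [set tt]
  (fun _ s => realizable p s && (sflat p s == X))
  [set e | [/\ cells H e, zt H (Cell e) = Some X & cell p `<=` closure e]]
  (fun _ s => cell (p + dir p s)) (finite_set1 _).
- move=> _ s _ /andP[rs /eqP sX]; have ps := dir_adj rs; split.
  + by apply/cellsP; exists (p + dir p s).
  + by rewrite zt_cell (adj_supp ps) dir_sgv// sX.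
  + apply/cell_closureP/closure_cellP; exists 0; last by rewrite addr0.
    by move=> j; rewrite mxE.
- move=> [] s [] s' _ /andP[rs _] _ /andP[rs' _] E; split=> //.
  have [d rd] := reg (p + dir p s).
  have := regular_sgv rd (dir_adj rs) (dir_adj rs') E.
  by rewrite !dir_sgv.
- move=> e [/cellsP[y ->] yX /cell_closureP/closure_cellP[z hz py]].
  exists tt, (sgv p (y + z - p)).
  have yz : cell (y + z) = cell y by apply: cell_pi; rewrite torus_pi_add_int.
  rewrite -yz in yX *; split=> //.
    rewrite sgv_real /= -(adj_supp py).
    by move: yX; rewrite zt_cell => -[->].
  by rewrite -(cell_same (dirE py)).
exists N; split=> //; rewrite NE fsbig_set1 XE local_count//.
Qed.

(** Each cell with support [X] is indexed by its lowest vertex, a coatom, and its sign vector there,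
    which is nonnegative for [nu]. *)
Lemma top_count X : int_poset H X ->
  exists N : nat,
    ([set e | cells H e /\ zt H (Cell e) = Some X] #= `I_N)%card /\
    N%:Z = Zsum_coatoms Pos Le Rk (Some X) (Some set0).
Proof.
move=> PX; have [nu nu_gen] := generic_functional.
pose vtx w := xget 0 [set p | [/\ w = Some (supp p), Ker (act p) = 0 & X (torus_pi p)]].
pose B := po_coatoms Pos Le (Some X) (Some set0).
have vtxP w : B w -> [/\ w = Some (supp (vtx w)), Ker (act (vtx w)) = 0 & X (torus_pi (vtx w))].
  by move=> /(coatomP _ PX)/(xgetPex 0).
have finB : finite_set B by apply: sub_finite_set finP => w [[]].
have [|||N [AN NE]] := @card_indexed_bij _ _ {ffun 'I_m -> option bool} B
  (fun w s => [&& realizable (vtx w) s, nonneg (vtx w) nu s & sflat (vtx w) s == X])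
  [set e | cells H e /\ zt H (Cell e) = Some X]
  (fun w s => cell (vtx w + dir (vtx w) s)) finB.
- move=> w s Bw /and3P[rs _ /eqP sX]; split.
    by apply/cellsP; exists (vtx w + dir (vtx w) s).
  by rewrite zt_cell (adj_supp (dir_adj rs)) dir_sgv// sX.
- move=> w s w' s' Bw /and3P[rs ns _] Bw' /and3P[rs' ns' _].
  have [wE _ _] := vtxP _ Bw; have [wE' _ _] := vtxP _ Bw'.
  move=> /cell_eqP[z hz E].
  set p := vtx w in rs ns wE E *; set p' := vtx w' in rs' ns' wE' E *.
  set y := p + dir p s in E.
  have mp : minimizer nu p y.
    by apply: nonneg_minimizer; rewrite ?dir_sgv//; exact: dir_adj.
  have mp' : minimizer nu (p' + z) (p' + dir p' s' + z).
    apply: minimizer_addz => //.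
    by apply: nonneg_minimizer; rewrite ?dir_sgv//; exact: dir_adj.
  have {}mp' : minimizer nu (p' + z) y.
    case: mp' => h1 h2; have E' := same_cell_sym E; split; first exact: adj_same h1.
    by move=> q' /(adj_same E); exact: h2.
  (* Equal cells are integral translates of each other upstairs; their lowest vertices are
     translated along and so agree on the torus. *)
  have pE := minimizer_unique nu_gen mp mp'.
  have piE : torus_pi p = torus_pi p' by rewrite pE torus_pi_add_int.
  split; first by rewrite wE wE' (supp_pi piE).
  rewrite -(dir_sgv rs) -(dir_sgv rs') -/p -/p' -(sgv_pi piE) -/y.
  rewrite (same_sgv p E) {2}pE; congr (sgv p _).
  by rewrite opprD addrACA subrr addr0.
- move=> e [/cellsP[y ->]]; rewrite zt_cell => -[yX].
  have [q mq] := minimizer_exists nu y essential.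
  have Kq := minimizer_vertex nu_gen mq.
  have qy := mq.1.
  have Xq : X (torus_pi q) by rewrite -yX (adj_supp qy); exact: flat_refl.
  have Bw : B (Some (supp q)) by apply/(coatomP _ PX); exists q.
  have [wE Kp Xp] := vtxP _ Bw; set w := Some (supp q) in Bw wE Kp Xp *.
  set p := vtx w in wE Kp Xp *.
  have piE : torus_pi q = torus_pi p.
    by apply: (supp_vertex Kp); case: wE => <-; exact: flat_refl.
  (* The cell is translated so that its lowest vertex becomes the lift fixed by [vtx]. *)
  have [z hz pE] := torus_pi_eqP piE.
  have mp : minimizer nu p (y + z) by rewrite pE; exact: minimizer_addz.
  have py := mp.1.
  have yz : cell (y + z) = cell y by apply: cell_pi; rewrite torus_pi_add_int.
  exists w, (sgv p (y + z - p)); split=> //; rewrite -/p.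
    rewrite sgv_real (minimizer_nonneg mp)/= -(adj_supp py).
    by rewrite (supp_cell yz) yX.
  by rewrite -(cell_same (dirE py)).
exists N; split=> //; rewrite NE; apply: eq_fsbigr => w; rewrite inE => Bw.
have [wE Kp Xp] := vtxP _ Bw; have [J Jp XE] := poset_contains PX Xp.
by have := vertex_count finP nu_gen Kp Jp; rewrite -XE -wE => ->.
Qed.

End Regular.

(** At a point of [X] with the fewest active forms, each active form vanishes on the directions of
    [X]: otherwise a short step inside [X] would deactivate it and activate no other. *)
Lemma supp_exists X : int_poset H X -> X <> set0 -> exists p, supp p = X.
Proof.
move=> PX /eqP/set0P[q Xq]; have [x0 x0q] := torus_pi_surj q; rewrite -x0q in Xq.
have exP : exists k, `[< exists2 p, X (torus_pi p) & #|act p| = k >].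
  by exists #|act x0|; apply/asboolP; exists x0.
case: (ex_minnP exP) => k /asboolP[p Xp pk] kmin.
have [J Jp XE] := poset_contains PX Xp.
exists p; rewrite XE; apply/seteqP; split; apply: flat_sub; first exact: Ker_sub.
apply/rV_subP => u uJ; apply/KerP => i ip; apply/eqP/negPn/negP => ui.
have [e e0 he] := nbhs_ray u (near_cells p).
have t0 : 0 < e / 2 by rewrite divr_gt0.
have /he hn : 0 <= e / 2 < e by lra.
set p' := p + (e / 2) *: u in hn.
have : (k <= #|act p'|)%N.
  apply: kmin; apply/asboolP; exists p' => //; rewrite XE; exists p' => //=.
  by rewrite /p' addrAC subrr add0r scalemx_sub.
rewrite leqNgt -pk proper_card//; apply/properP; split.
  apply/fintype.subsetP => j jp'; rewrite in_act; apply: contraT => jp.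
  have [_ /(_ jp) /same_cell1_int] := hn j.
  by rewrite (negbTE jp) -in_act jp'.
exists i => //; have [h1 _] := hn i; rewrite in_act in ip; apply/negP; rewrite in_act => ip'.
have : ev (a i) (p' - p) = 0.
  by apply: int_norm_lt1; [rewrite -ell_sub rpredB|exact: h1].
rewrite /p' addrAC subrr add0r evZ => /eqP; rewrite mulf_eq0 (negbTE ui) orbF.
by rewrite gt_eqF.
Qed.
End IntersectionPoset.
End Arrangement.

(** * Cell counts for the arrangement and the chain formula *)

Section RegularArrangement.
Variables (R : realType) (n : nat) (H : set (set (torus R n))).
Hypothesis hH : toric_arrangement H.
Hypothesis hreg : regular_cell_complex R (cells H).
Implicit Types (X Y e : set (torus R n)).

Lemma arrangement_forms : exists (m : nat) (a : 'I_m -> 'cV[R]_n) (b : 'I_m -> R),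
  (forall i j, a i j 0 \is a Num.int) /\ H = [set hyp a b i | i in [set: 'I_m]].
Proof.
have [/finite_seqP[s sE] Hhyp] := hH.
have /choice[ab abP] : forall i : 'I_(size s), exists ab : 'cV[R]_n * R,
    (forall j, ab.1 j 0 \is a Num.int) /\
    nth set0 s i = @torus_pi R n @` [set x | ev ab.1 x - ab.2 \is a Num.int].
  move=> i; have Hi : H (nth set0 s i) by rewrite sE /= mem_nth.
  by have [a [b h]] := toric_hyperplane_int (Hhyp _ Hi); exists (a, b).
exists (size s), (fun i => (ab i).1), (fun i => (ab i).2); split=> [i j|].
  by have [h _] := abP i; exact: h.
rewrite sE; apply/seteqP; split=> [h hs|_ [i _ <-]].
  have hi : (index h s < size s)%N by rewrite index_mem.
  exists (Ordinal hi) => //; have [_ E] := abP (Ordinal hi).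
  by rewrite /hyp /ell -E /= nth_index.
by have [_ E] := abP i; rewrite /hyp /ell -E /= mem_nth.
Qed.

Lemma cells_regular e : cells H e -> exists d, regular_cell R d e.
Proof. by case: hreg => _ _ _ [dim h] /h [re _]; exists (dim e). Qed.

Lemma card_cells_above X Y e : int_poset H X -> cells H e ->
  zt H (Cell e) = Some Y -> Y `<=` X ->
  exists N : nat,
    ([set e' | (cells H e' /\ zt H (Cell e') = Some X) /\ e `<=` closure e'] #= `I_N)%card /\
    N%:Z = Zsum (hat_poset H) (@hat_le R n) (@hat_rank R n) (Some X) (Some Y).
Proof.
have [m [a [b [aint HE]]]] := arrangement_forms.
move=> PX Ke; have [p eE] := (cellsP aint HE e).1 Ke.
rewrite {1 2}eE (zt_cell aint HE) => -[<-] YX.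
have reg y : exists d, regular_cell R d (cell a b y).
  by apply: cells_regular; apply/(cellsP aint HE); exists y.
have finC : finite_set (cells H) by case: hreg.
have Xp : X (torus_pi p) by apply: YX; exact: flat_refl.
have [N [h1 h2]] := step_count aint HE finC reg PX Xp; exists N; split=> //.
by move: h1; congr card_eq; apply/seteqP; split=> e' [] // [].
Qed.

Lemma card_cells_supp X : int_poset H X ->
  exists N : nat,
    ([set e | cells H e /\ zt H (Cell e) = Some X] #= `I_N)%card /\
    N%:Z = Zsum_coatoms (hat_poset H) (@hat_le R n) (@hat_rank R n) (Some X) (Some set0).
Proof.
have [m [a [b [aint HE]]]] := arrangement_forms.
have reg y : exists d, regular_cell R d (cell a b y).
  by apply: cells_regular; apply/(cellsP aint HE); exists y.
have finC : finite_set (cells H) by case: hreg.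
exact: (top_count aint HE finC reg).
Qed.

Lemma exists_cell_supp X : int_poset H X -> X <> set0 ->
  exists2 e, cells H e & zt H (Cell e) = Some X.
Proof.
have [m [a [b [aint HE]]]] := arrangement_forms => PX XN.
have [p <-] := supp_exists aint HE PX XN.
by exists (cell a b p); [apply/(cellsP aint HE); exists p|rewrite (zt_cell aint HE)].
Qed.

Lemma zt_cell_neq0 e : cells H e -> zt H (Cell e) <> Some set0.
Proof.
have [m [a [b [aint HE]]]] := arrangement_forms => /(cellsP aint HE)[p ->].
by rewrite (zt_cell aint HE) => -[]; exact: supp_neq0.
Qed.

End RegularArrangement.

(** Closure is idempotent, so comparing consecutive cells of a chain is enough. *)
Lemma closure_chain (T : topologicalType) (g : nat -> set T) (K : nat) :
  (forall i, (i < K)%N -> g i `<=` closure (g i.+1)) ->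
  forall i j, (i < j)%N -> (j <= K)%N -> g i `<=` closure (g j).
Proof.
move=> h i; elim=> // j IH; rewrite ltnS leq_eqVlt => /predU1P[<-|ij] jK; first exact: h.
apply: subset_trans (IH ij (ltnW jK)) _.
by have /closureS := h j jK; rewrite -(iffLR (closure_id _) (@closed_closure _ (g j.+1))).
Qed.

Theorem theorem3p13 (R : realType) (n : nat) (H : set (set (torus R n)))
  (hH : toric_arrangement H)
  (hreg : regular_cell_complex R (cells H))
  (k : nat) (hk : (2 <= k)%N)
  (x : 'I_k.+1 -> option (set (torus R n)))
  (hx : po_chain (hat_poset H) (@hat_le R n) x)
  (hx0 : x ord0 = None)
  (hxk : x ord_max = Some set0) :
  exists N : nat,
    ([set y : 'I_k.+1 -> face R n |
       po_chain (face_poset H) (@dual_face_le R n) y /\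
       forall i, zt H (y i) = x i] #= `I_N)%card /\
    N%:Z =
      (\prod_(2 <= i < k)
         Zsum (hat_poset H) (@hat_le R n) (@hat_rank R n)
           (x (inord i.-1)) (x (inord i))) *
      Zsum_coatoms (hat_poset H) (@hat_le R n) (@hat_rank R n)
        (x (inord k.-1)) (x (inord k)).
Proof.
case: k hk x hx hx0 hxk => [|[|K]] // _ x [xP xlt] x0 xK.
have xv i : (0 < i < K.+2)%N ->
    exists X, [/\ x (inord i) = Some X, int_poset H X & X <> set0].
  move=> /andP[i0 iK]; have iE : nat_of_ord (inord i : 'I_K.+3) = i by rewrite inordK// ltnS ltnW.
  have := xP (inord i); case E : (x (inord i)) => [X|] PX.
    exists X; split=> // X0.
    by have [|_] := xlt (inord i) ord_max; [rewrite iE|rewrite E X0 xK].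
  by have [|_] := xlt ord0 (inord i); [rewrite iE|rewrite E x0].
(* Here [k = K.+2]; chains are built downwards from [y_(k-1)], so that [B j]
   contains the candidates for [y_(k-1-j)]. *)
pose B j := [set e : set (torus R n) | cells H e /\ zt H (Cell e) = x (inord (K.+1 - j))].
pose r (e' e : set (torus R n)) := e `<=` closure e'.
(* [c j] counts the choices at level [j]; beyond [K] its value is irrelevant. *)
have /choice[c cP] : forall j, exists N : nat, (j <= K)%N ->
    if j is j'.+1 then
      (forall e, B j' e -> ([set e' | B j e' /\ r e' e] #= `I_N)%card) /\
      N%:Z = Zsum (hat_poset H) (@hat_le R n) (@hat_rank R n)
        (x (inord (K.+1 - j))) (x (inord (K.+1 - j')))
    else (B 0%N #= `I_N)%card /\
      N%:Z = Zsum_coatoms (hat_poset H) (@hat_le R n) (@hat_rank R n)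
        (x (inord K.+1)) (x (inord K.+2)).
  case=> [|j].
    have [X [xE PX _]] := xv K.+1 (ltac:(by rewrite ltnSn)).
    have [N [h1 h2]] := card_cells_supp hH hreg PX; exists N => _.
    rewrite /B subn0 xE; split=> //; rewrite h2; congr Zsum_coatoms.
    rewrite -xK; congr x; apply: val_inj => /=; by rewrite inordK.
  have [jK|jK] := leqP j.+1 K; last by exists 0%N.
  have [X [xE PX _]] := xv (K.+1 - j.+1)%N (ltac:(lia)).
  have [Y [yE PY YN]] := xv (K.+1 - j)%N (ltac:(lia)).
  have YX : Y `<=` X.
    have [|] := xlt (inord (K.+1 - j.+1)) (inord (K.+1 - j)); last by rewrite xE yE.
    by rewrite !inordK; lia.
  (* One cell with support [Y] fixes [N]; every other such cell gives the same number, since both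
     counts equal the same [Zsum]. *)
  have [e0 Ke0 ze0] := exists_cell_supp hH PY YN.
  have [N [_ hN]] := card_cells_above hH hreg PX Ke0 ze0 YX.
  exists N => _; rewrite xE yE; split=> // e [Ke ze]; rewrite yE in ze.
  have [N' [h1 h2]] := card_cells_above hH hreg PX Ke ze YX.
  have -> : N = N' by apply/eqP; rewrite -eqz_nat hN h2.
  by rewrite /B xE; move: h1; congr card_eq.
exists (\prod_(i < K.+1) c i)%N; split; last first.
  rewrite -natz natr_prod big_ord_recl /= mulrC; congr (_ * _); last first.
    by have [_ <-] := cP 0%N isT; rewrite natz.
  (* Levels run downwards while the product runs upwards from 2, so the index is reversed and
     shifted. *)
  rewrite big_nat_rev /= -{1}[2%N]add0n big_addn subn2 /= big_mkord.
  apply: eq_bigr => i _; have iK := ltn_ord i; have [|_] := cP i.+1; first by lia.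
  rewrite natz => ->; congr Zsum; congr x; congr inord; lia.
have cardG := @card_sequences _ set0 B r c K (cP 0%N isT).1 _.
have {}cardG := cardG (fun i e iK => (cP i.+1 iK).1 e).
apply: card_eq_trans cardG; set G := [set y : nat -> _ | _].
(* The ends are forced: over [None] lies only the whole torus and over [Some set0] only the empty
   face, so they add no choices. *)
pose F (g : nat -> set (torus R n)) (i : 'I_K.+3) : face R n :=
  if i == 0%N :> nat then WholeTorus R n
  else if i == K.+2 :> nat then EmptyFace R n else Cell (g (K.+1 - i)%N).
suff -> : [set y : 'I_K.+3 -> face R n | po_chain (face_poset H) (@dual_face_le R n) y /\
       forall i, zt H (y i) = x i] = F @` G.
  apply: inj_card_eq => g g'; rewrite !inE => -[_ _ g0] [_ _ g0'] E.
  apply/funext => j; have [jK|jK] := leqP j K; last by rewrite g0// g0'.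
  have := congr1 (fun h : 'I_K.+3 -> face R n => h (inord (K.+1 - j))) E.
  rewrite /F inordK; last by lia.
  rewrite !ifF; try lia.
  by move=> [] ; rewrite subKn; last lia.
apply/seteqP; split=> [y [[yP ylt] yx]|_ [g [gB gr g0] <-]] /=.
  pose cellof (f : face R n) := if f is Cell e then e else set0.
  have yv i : (0 < i < K.+2)%N -> exists e, [/\ y (inord i) = Cell e, cells H e & zt H (Cell e) = x (inord i)].
    move=> iK; have [X [xE _ XN]] := xv i iK; have := yx (inord i); have := yP (inord i).
    case: (y (inord i)) => [|e|]; rewrite xE //=; last by move=> _ [] /esym.
    by move=> Ke ze; exists e.
  pose g j := if (j <= K)%N then cellof (y (inord (K.+1 - j))) else set0.
  exists g.
    split=> [j jK|j jK|j jK]; rewrite /g.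
    - by rewrite jK; have [e [-> ? ?]] := yv (K.+1 - j)%N (ltac:(lia)).
    - rewrite jK (ltnW jK); have [] := ylt (inord (K.+1 - j.+1)) (inord (K.+1 - j)).
        by rewrite !inordK; lia.
      have [e [-> _ _]] := yv (K.+1 - j)%N (ltac:(lia)).
      by have [e' [-> _ _]] := yv (K.+1 - j.+1)%N (ltac:(lia)).
    - by rewrite leqNgt jK.
  apply/funext => i; rewrite /F; case: eqP => [i0|/eqP i0].
    have -> : i = ord0 by exact: val_inj.
    by have := yx ord0; rewrite x0; case: (y ord0).
  case: eqP => [iK|/eqP iK].
    have -> : i = ord_max by exact: val_inj.
    have := yx ord_max; have := yP ord_max; rewrite xK; case: (y ord_max) => [|e|] //=.
    by move=> Ke ze; have := zt_cell_neq0 hH Ke.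
  have iK' := ltn_ord i; rewrite /g leq_subLR ifT; last by lia.
  rewrite subKn; last by lia.
  have [e [E _ _]] := yv i (ltac:(lia)); rewrite inord_val in E.
  by rewrite inord_val E.
have gz (i : 'I_K.+3) : zt H (F g i) = x i.
  rewrite /F; case: eqP => [i0|/eqP i0].
    by rewrite /= -x0; congr x; exact: val_inj.
  case: eqP => [iK|/eqP iK]; first by rewrite /= -xK; congr x; exact: val_inj.
  have iK' := ltn_ord i; have [|_ ->] := gB (K.+1 - i)%N; first by lia.
  rewrite subKn; last by lia.
  by rewrite inord_val.
split=> //; split=> [i|i j ij].
  rewrite /F; case: eqP => [i0|/eqP i0] //; case: eqP => [iK|/eqP iK] //=.
  by have iK' := ltn_ord i; have [|//] := gB (K.+1 - i)%N; lia.
split; last by move=> E; have [_] := xlt _ _ ij; rewrite -!gz E.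
rewrite /dual_face_le /F; have jK := ltn_ord j.
case: (eqVneq (i : nat) 0%N) => [i0|i0]; first by case: ifP => //; case: ifP.
rewrite (_ : (j == 0%N :> nat) = false); last by lia.
case: ifP => // jK'; rewrite ifF; last by lia.
by apply: (@closure_chain _ g K) => //; lia.
Qed.
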